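(* Let $\pi:(M,g_M)\to(B,g_B)$ be a harmonic semi-Riemannian submersion and let $\varepsilon\in\{1,-1\}$. Endow $M\times\mathbb{R}$ and $B\times\mathbb{R}$ with the metrics $g_M+\varepsilon\,dt^2$ and $g_B+\varepsilon\,dt^2$. Let $u\in C^2(B)$, let $F:B\to B\times\mathbb{R}$, $F(x)=(x,u(x))$, be its graph map, and let $\widetilde F:M\to M\times\mathbb{R}$ be the map $\widetilde F(x)=(x,u(\pi(x)))$. Then $\widetilde F$ is a graphical translating soliton if and only if $F$ is a graphical translating soliton.
   Context: A semi-Riemannian submersion $\pi:(M,g_M)\to(B,g_B)$ is a smooth surjective submersion whose fibers are nondegenerate submanifolds and such that $d\pi_x$ restricts to a linear isometry from the horizontal space $(\ker d\pi_x)^{\perp}$ onto $T_{\pi(x)}B$. It is called harmonic if the mean curvature vector of every fiber vanishes. For a $C^2$ function $w$ on a semi-Riemannian manifold $(N,g)$, the graph map $x\mapsto(x,w(x))$ into $(N\times\mathbb{R},g+\varepsilon\,dt^2)$ is a graphical translating soliton if it is a semi-Riemannian hypersurface (nondegenerate induced metric) and its mean curvature vector $\vec H$ (the unnormalized trace of the second fundamental form) satisfies $\vec H=\partial_t^\perp$, where $\partial_t^\perp$ is the normal component of the vector field $\partial_t$ along it. *)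

(* Defs.v *)
(* Tangent vectors are row vectors of chart components, so
   a linear map A acts as v *m A, and 'J f y has the partial derivatives of f
   as its rows.  Every dimension, 0 included, is allowed. *)
From HB Require Import structures.
From mathcomp Require Import all_boot all_order all_algebra.
From mathcomp Require Import all_classical all_reals all_analysis.

Set Implicit Arguments.
Unset Strict Implicit.
Unset Printing Implicit Defensive.

Import Order.TTheory GRing.Theory Num.Theory.
Import numFieldNormedType.Exports.

Local Open Scope classical_set_scope.
Local Open Scope ring_scope.

Section Differentiability.
Variables (R : realType) (n : nat) (W : normedModType R).

(* Meant for open U: only the germ of f at each point of U matters. *)
Fixpoint Ck_on (k : nat) (U : set 'rV[R]_n) (f : 'rV[R]_n -> W) : Prop :=
  match k with
  | 0 => forall y, U y -> {for y, continuous f}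
  | k'.+1 => (forall y, U y -> differentiable f y) /\
             (forall v, Ck_on k' U (fun y => 'D_v f y))
  end.

Definition smooth_on (U : set 'rV[R]_n) (f : 'rV[R]_n -> W) : Prop :=
  forall k, Ck_on k U f.

End Differentiability.

Section PointwiseAlgebra.
Variables (R : realType) (n : nat).

(* A matrix G is the bilinear form (v, w) |-> v *m G *m w^T. *)
Definition form (G : 'M[R]_n) (v w : 'rV[R]_n) : R := (v *m G *m w^T) 0 0.

(* The rows of E span a subspace; gram is the restriction of G to it. *)
Definition gram k (G : 'M[R]_n) (E : 'M[R]_(k, n)) : 'M[R]_k :=
  E *m G *m E^T.

Definition has_negdef_subspace (G : 'M[R]_n) (k : nat) : Prop :=
  exists E : 'M[R]_(k, n), forall v : 'rV[R]_k, v != 0 -> form G (v *m E) (v *m E) < 0.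

Definition has_index (G : 'M[R]_n) (nu : nat) : Prop :=
  has_negdef_subspace G nu /\
  forall k, has_negdef_subspace G k -> (k <= nu)%N.

(* v minus its G-orthogonal projection on the row space of E; meaningful when
   the rows of E form a basis of a G-nondegenerate subspace. *)
Definition normal_part k (G : 'M[R]_n) (E : 'M[R]_(k, n)) (v : 'rV[R]_n) :
    'rV[R]_n :=
  v - v *m G *m E^T *m invmx (gram G E) *m E.

(* The unnormalized trace h^{ab} (D_a E_b)^perp of the second fundamental form
   on the tangent basis E, where A a b is the ambient covariant derivative
   D_a E_b and h is the induced metric. *)
Definition mean_curvature k (G : 'M[R]_n) (E : 'M[R]_(k, n))
    (A : 'I_k -> 'I_k -> 'rV[R]_n) : 'rV[R]_n :=
  \sum_(a < k) \sum_(b < k) invmx (gram G E) a b *: normal_part G E (A a b).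

End PointwiseAlgebra.

Section LeviCivita.
Variables (R : realType).

Definition basis_vec n (i : 'I_n) : 'rV[R]_n := delta_mx 0 i.

(* Row vector with l-th entry v^i w^j Gamma_{ij}^l, where
   Gamma_{ij}^l = 1/2 (d_i g_{js} + d_j g_{is} - d_s g_{ij}) g^{sl}. *)
Definition christoffel n (g : 'rV[R]_n -> 'M[R]_n) (y v w : 'rV[R]_n) :
    'rV[R]_n :=
  2^-1 *: (\row_s (form ('D_v g y) w (basis_vec s)
                   + form ('D_w g y) v (basis_vec s)
                   - form ('D_(basis_vec s) g y) v w) *m invmx (g y)).

(* Covariant derivative at y, in the direction v, of the vector field X along
   the map f, for the Levi-Civita connection of g. *)
Definition cov_deriv k n (g : 'rV[R]_n -> 'M[R]_n) (f X : 'rV[R]_k -> 'rV[R]_n)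
    (v y : 'rV[R]_k) : 'rV[R]_n :=
  'D_v X y + christoffel g (f y) ('D_v f y) (X y).

End LeviCivita.

Record chart (R : realType) (T : topologicalType) (n : nat) := Chart {
  cdom : set T ;
  coord :> T -> 'rV[R]_n ;
  point : 'rV[R]_n -> T ;
  cdom_open : open cdom ;
  cimg_open : open (coord @` cdom) ;
  coordK : forall p, cdom p -> point (coord p) = p ;
  coord_continuous : forall p, cdom p -> {for p, continuous coord} ;
  point_continuous : forall p, cdom p -> {for coord p, continuous point} }.

Definition cimg (R : realType) (T : topologicalType) (n : nat)
  (c : chart R T n) : set 'rV[R]_n := c @` cdom c.

(* Coordinate expression of a map, and the open set where it is defined. *)
Definition local_dom (R : realType) (S T : topologicalType) (m n : nat)
    (c : chart R S m) (d : chart R T n) (h : S -> T) : set 'rV[R]_m :=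
  c @` (cdom c `&` h @^-1` cdom d).

Definition local_rep (R : realType) (S T : topologicalType) (m n : nat)
    (c : chart R S m) (d : chart R T n) (h : S -> T) : 'rV[R]_m -> 'rV[R]_n :=
  d \o h \o point c.

Record smoothManifold (R : realType) (n : nat) := SmoothManifold {
  carrier :> topologicalType ;
  carrier_hausdorff : hausdorff_space carrier ;
  carrier_second_countable : @second_countable carrier ;
  chart_index : Type ;
  chart_at : chart_index -> chart R carrier n ;
  chart_cover : forall p : carrier, exists i, cdom (chart_at i) p ;
  transition_smooth : forall i j,
    smooth_on (local_dom (chart_at i) (chart_at j) id)
              (local_rep (chart_at i) (chart_at j) id) }.

Record semiRiemannian (R : realType) (n : nat) := SemiRiemannian {
  manifold :> smoothManifold R n ;
  metric : chart_index manifold -> 'rV[R]_n -> 'M[R]_n ;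
  metric_smooth : forall i, smooth_on (cimg (chart_at i)) (metric i) ;
  metric_sym : forall i y, cimg (chart_at i) y -> (metric i y)^T = metric i y ;
  metric_nondegenerate : forall i y,
    cimg (chart_at i) y -> metric i y \in unitmx ;
  metric_index : exists nu : nat, forall i y,
    cimg (chart_at i) y -> has_index (metric i y) nu ;
  metric_transition : forall i j y,
    let tau := local_rep (chart_at i) (chart_at j) id in
    local_dom (chart_at i) (chart_at j) id y ->
    metric i y = 'J tau y *m metric j (tau y) *m ('J tau y)^T }.

Definition smooth_map (R : realType) (m n : nat) (M : smoothManifold R m)
    (B : smoothManifold R n) (h : M -> B) : Prop :=
  continuous h /\
  forall (i : chart_index M) (j : chart_index B),
    smooth_on (local_dom (chart_at i) (chart_at j) h)
              (local_rep (chart_at i) (chart_at j) h).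

Definition Ck_function (R : realType) (n k : nat) (N : smoothManifold R n)
    (w : N -> R) : Prop :=
  forall i : chart_index N, Ck_on k (cimg (chart_at i)) (w \o point (chart_at i)).

Section Submersion.
Variables (R : realType) (m n : nat).

Definition vertical (J : 'M[R]_(m, n)) (v : 'rV[R]_m) : Prop := v *m J = 0.

Definition horizontal (G : 'M[R]_m) (J : 'M[R]_(m, n)) (v : 'rV[R]_m) : Prop :=
  forall w, vertical J w -> form G v w = 0.

Variables (M : semiRiemannian R m) (B : semiRiemannian R n) (h : M -> B).

Definition semi_riemannian_submersion : Prop :=
  [/\ smooth_map h, (forall q, exists p, h p = q) &
    forall (i : chart_index M) (j : chart_index B) y,
      local_dom (chart_at i) (chart_at j) h y ->
      let f := local_rep (chart_at i) (chart_at j) h in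
      let J := 'J f y in
      let GM := metric i y in
      let GB := metric j (f y) in
      [/\ row_full J,
          (forall v, vertical J v ->
             (forall w, vertical J w -> form GM v w = 0) -> v = 0),
          (forall v w, horizontal GM J v -> horizontal GM J w ->
             form GB (v *m J) (w *m J) = form GM v w) &
          (forall z, exists! v, horizontal GM J v /\ v *m J = z)]].

(* The tangent space of the fiber through p is ker dh_p.  Its second fundamental
   form at p is computed, as for any submanifold, from ambient local vector
   fields V a that are tangent to the fiber along it. *)
Definition minimal_fibers : Prop :=
  forall (i : chart_index M) (j : chart_index B) y,
    local_dom (chart_at i) (chart_at j) h y ->
    let f := local_rep (chart_at i) (chart_at j) h in
    forall (k : nat) (U : set 'rV[R]_m) (V : 'I_k -> 'rV[R]_m -> 'rV[R]_m),
      open U -> U y -> U `<=` cimg (chart_at i) ->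
      (forall a, smooth_on U (V a)) ->
      (forall a z, U z ->
         h (point (chart_at i) z) = h (point (chart_at i) y) ->
         vertical ('J f z) (V a z)) ->
      let E := \matrix_(a < k) V a y in
      row_free E -> (E == kermx ('J f y))%MS ->
      mean_curvature (metric i y) E
        (fun a b => cov_deriv (metric i) id (V b) (V a y) y) = 0.

Definition harmonic_submersion : Prop :=
  semi_riemannian_submersion /\ minimal_fibers.

End Submersion.

Section Soliton.
Variables (R : realType) (n : nat) (N : semiRiemannian R n) (eps : R).

(* N * R carries the charts (p, t) |-> (c p, t) for c a chart of N. *)
Definition prod_coord (i : chart_index N) (p : N * R) : 'rV[R]_(n + 1) :=
  row_mx (chart_at i p.1) p.2%:M.

(* Components of g + eps dt^2 in such a chart. *)
Definition prod_metric (i : chart_index N) (z : 'rV[R]_(n + 1)) :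
    'M[R]_(n + 1) :=
  block_mx (metric i (lsubmx z)) 0 0 eps%:M.

Definition d_t : 'rV[R]_(n + 1) := row_mx 0 1%:M.

(* Nondegeneracy and the soliton equation are tensorial; they are expressed in
   every chart c of the source N and the product chart over c of the target. *)
Definition graphical_translating_soliton (F : N -> N * R) : Prop :=
  exists w : N -> R,
  [/\ Ck_function 2 w,
      F = (fun x => (x, w x)) &
      forall (i : chart_index N) (y : 'rV[R]_n), cimg (chart_at i) y ->
        let f := prod_coord i \o F \o point (chart_at i) in
        let G := prod_metric i in
        let E := 'J f y in
        gram (G (f y)) E \in unitmx /\
        mean_curvature (G (f y)) E
          (fun a b => cov_deriv G f (fun z => 'D_(basis_vec R b) f z)
                                (basis_vec R a) y)
        = normal_part (G (f y)) E d_t].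

End Soliton.

(* Main.v *)
Require Import Defs.
From HB Require Import structures.
From mathcomp Require Import all_boot all_order all_algebra.
From mathcomp Require Import all_classical all_reals all_analysis.
From mathcomp Require Import ring lra.

Set Implicit Arguments.
Unset Strict Implicit.
Unset Printing Implicit Defensive.

Import Order.TTheory GRing.Theory Num.Theory.
Import numFieldNormedType.Exports.

Local Open Scope classical_set_scope.
Local Open Scope ring_scope.

(** In charts, with w the height function of a graph over (N, g) and Hess w its
    covariant Hessian, the acceleration of the graph is Hess w times d_t up to
    tangent vectors.  Since d_t is never tangent to a graph, the soliton
    equation says exactly that h = g + eps dw dw^T is invertible and that the
    h-trace of Hess w is 1 ([graph_soliton_eq]).

    It remains to compare this scalar equation for u on B and for its pullback
    on M.  Let J be the Jacobian of the projection f in charts.  The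
    submersion condition says that the inverse metrics correspond under J
    ([cometric_submersion]).  Hence the inverse of g_M + eps dw dw^T, for the
    pullback w of u, is the vertical part of the inverse of g_M plus the
    horizontal lift of the inverse of g_B + eps du du^T, and one of these
    matrices is invertible if and only if the other is ([graph_gram_unit],
    [graph_gram_inv]).

    By the chain rule ([hess_form_comp]) the Hessian of w is the pullback of
    the Hessian of u plus the second fundamental form S of f paired with du.
    The first term contributes the trace on B.  The contribution of S vanishes:
    S is zero on pairs of horizontal vectors, because f is a submersion
    ([second_form_horizontal]; this uses the symmetry of second derivatives,
    [derive_comm]), and its trace over the vertical space is minus the
    projected mean curvature of the fiber, hence zero because the fibers are
    minimal ([second_form_vertical_trace]).

    Smooth vertical and horizontal fields are built with adjugate matrices,
    which equal inverses up to a scalar factor and are smooth because they are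
    polynomial in the entries. *)

Local Notation form := Defs.form.
Local Notation point := Defs.point.

(** * Bilinear forms as matrices *)

Section Forms.
Variables (R : realType) (n : nat).
Implicit Types (G : 'M[R]_n) (v w : 'rV[R]_n).

Lemma form_sym G v w : G^T = G -> form G v w = form G w v.
Proof.
move=> sG; rewrite /Defs.form -[in LHS](trmxK (v *m G *m w^T)) mxE.
by rewrite !trmx_mul trmxK sG mulmxA.
Qed.

Lemma form_addl G v v' w : form G (v + v') w = form G v w + form G v' w.
Proof. by rewrite /Defs.form !mulmxDl mxE. Qed.

Lemma form_scalel G a v w : form G (a *: v) w = a * form G v w.
Proof. by rewrite /Defs.form -!scalemxAl mxE. Qed.

Lemma form_addr G v w w' : form G v (w + w') = form G v w + form G v w'.
Proof. by rewrite /Defs.form linearD mulmxDr mxE. Qed.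

Lemma form_scaler G a v w : form G v (a *: w) = a * form G v w.
Proof. by rewrite /Defs.form linearZ/= -scalemxAr mxE. Qed.

Lemma form_addm G G' v w : form (G + G') v w = form G v w + form G' v w.
Proof. by rewrite /Defs.form mulmxDr mulmxDl mxE. Qed.

Lemma form_scalem a G v w : form (a *: G) v w = a * form G v w.
Proof. by rewrite /Defs.form -scalemxAr -scalemxAl mxE. Qed.

Lemma form_nondeg G v v' : G \in unitmx ->
  (forall w, form G v w = form G v' w) -> v = v'.
Proof.
move=> uG E; apply: (can_inj (mulmxK uG)); apply/rowP => i.
by have := E (delta_mx 0 i); rewrite /Defs.form trmx_delta -!colE !mxE.
Qed.

Lemma bilinear_mx (b : 'rV[R]_n -> 'rV[R]_n -> R) x v :
  (forall a x x' v, b (a *: x + x') v = a * b x v + b x' v) ->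
  (forall a x v v', b x (a *: v + v') = a * b x v + b x v') ->
  b x v = form (\matrix_(i, j) b (delta_mx 0 i) (delta_mx 0 j)) x v.
Proof.
move=> bl br.
have bl0 u : b 0 u = 0.
  by have := bl (-1) 0 0 u; rewrite scaler0 addr0 mulN1r addNr.
have br0 u : b u 0 = 0.
  by have := br (-1) u 0 0; rewrite scaler0 addr0 mulN1r addNr.
have bls I (r : seq I) (c : I -> R) (e : I -> 'rV[R]_n) u :
    b (\sum_(i <- r) c i *: e i) u = \sum_(i <- r) c i * b (e i) u.
  by elim: r => [|i r IH]; rewrite ?big_nil// !big_cons bl IH.
have brs I (r : seq I) (c : I -> R) (e : I -> 'rV[R]_n) u :
    b u (\sum_(i <- r) c i *: e i) = \sum_(i <- r) c i * b u (e i).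
  by elim: r => [|i r IH]; rewrite ?big_nil// !big_cons br IH.
rewrite {1}(row_sum_delta x) {1}(row_sum_delta v) bls /Defs.form -mulmxA mxE.
apply: eq_bigr => i _; rewrite brs mxE; congr (_ * _).
by apply: eq_bigr => j _; rewrite !mxE mulrC.
Qed.

End Forms.

(** Contracts the covector of a linear functional with a vector; this is how
    the row vector in the formula for the Christoffel symbols is read. *)
Lemma scalar_row (R : realType) n (k : 'rV[R]_n -> R) s :
  (forall a s s', k (a *: s + s') = a * k s + k s') ->
  ((\row_i k (basis_vec R i)) *m s^T) 0 0 = k s.
Proof.
move=> kl.
have k0 : k 0 = 0 by have := kl (-1) 0 0; rewrite scaler0 addr0 mulN1r addNr.
have ks I (r : seq I) (c : I -> R) (e : I -> 'rV[R]_n) :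
    k (\sum_(i <- r) c i *: e i) = \sum_(i <- r) c i * k (e i).
  by elim: r => [|i r IH]; rewrite ?big_nil// !big_cons kl IH.
rewrite [in RHS](row_sum_delta s) ks mxE.
by apply: eq_bigr => i _; rewrite !mxE mulrC.
Qed.

Lemma form_oppl (R : realType) n (G : 'M[R]_n) v w :
  form G (- v) w = - form G v w.
Proof. by rewrite -scaleN1r form_scalel mulN1r. Qed.

Lemma form_oppr (R : realType) n (G : 'M[R]_n) v w :
  form G v (- w) = - form G v w.
Proof. by rewrite -scaleN1r form_scaler mulN1r. Qed.

Lemma form_mulmx (R : realType) m n (G : 'M[R]_n) (A B : 'M[R]_(m, n)) v w :
  form (A *m G *m B^T) v w = form G (v *m A) (w *m B).
Proof. by rewrite /Defs.form trmx_mul !mulmxA. Qed.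

Lemma form_row (R : realType) m n (G : 'M[R]_n) (A : 'M[R]_(m, n)) i j :
  form G (row i A) (row j A) = (A *m G *m A^T) i j.
Proof. by rewrite !rowE -form_mulmx /Defs.form trmx_delta -rowE -colE !mxE. Qed.

(** * Linear algebra of a semi-Riemannian submersion *)

Section LinearAlgebra.
Variable R : realType.

Lemma trmx_inv_sym n (G : 'M[R]_n) : G^T = G -> (invmx G)^T = invmx G.
Proof. by move=> sG; rewrite trmx_inv sG. Qed.

Lemma form_inj p q (A B : 'M[R]_(p, q)) :
  (forall (v : 'rV_p) (w : 'rV_q),
     (v *m A *m w^T) 0 0 = (v *m B *m w^T) 0 0) -> A = B.
Proof.
move=> AB; apply/matrixP=> i j; have := AB (delta_mx 0 i) (delta_mx 0 j).
by rewrite -!rowE trmx_delta -!colE !mxE.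
Qed.

Section Submersion.
Variables (m n : nat) (GM : 'M[R]_m) (GB : 'M[R]_n) (J : 'M[R]_(m, n)).
Hypotheses (sM : GM^T = GM) (uM : GM \in unitmx).

(** Row vectors of the base are read here as covectors: z is pulled back along J
    and turned into a vector with GM.  The rows of this matrix span the
    horizontal space, which is how horizontal vectors are parametrized below. *)
Definition covector_lift : 'M[R]_(n, m) := J^T *m invmx GM.

Lemma covector_lift_horizontal (z : 'rV[R]_n) :
  horizontal GM J (z *m covector_lift).
Proof.
move=> w wJ; rewrite /Defs.form /covector_lift !mulmxA mulmxKV//.
by rewrite -mulmxA -trmx_mul wJ trmx0 mulmx0 mxE.
Qed.

Hypothesis J_full : row_full J.
Hypothesis vert_nondeg : forall v, vertical J v ->
  (forall w, vertical J w -> form GM v w = 0) -> v = 0.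
Hypothesis isom : forall v w, horizontal GM J v -> horizontal GM J w ->
  form GB (v *m J) (w *m J) = form GM v w.

(** For P := L J, with L the lift above, the isometry condition on the lifts of
    v and w reads P GB P = P.  Moreover P is invertible, since a covector in its
    kernel lifts to a vector that is both vertical and horizontal, hence 0. *)
Lemma cometric_submersion : covector_lift *m J = invmx GB.
Proof.
set P := covector_lift *m J.
have sP : P^T = P.
  by rewrite /P /covector_lift !trmx_mul trmxK (trmx_inv_sym sM) mulmxA.
have PGP : P *m GB *m P = P.
  apply: form_inj => v w.
  have := isom (covector_lift_horizontal v) (covector_lift_horizontal w).
  rewrite /Defs.form -!(mulmxA _ covector_lift J) -/P.
  rewrite (trmx_mul w P) sP (trmx_mul w covector_lift) => E.
  rewrite !mulmxA in E *; rewrite E.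
  by rewrite /P /covector_lift trmx_mul trmxK (trmx_inv_sym sM) !mulmxA mulmxKV.
have kP (z : 'rV_n) : z *m P = 0 -> z = 0.
  move=> zP; have vz : z *m covector_lift = 0.
    apply: vert_nondeg; first by rewrite /vertical -mulmxA.
    exact: covector_lift_horizontal.
  have : z *m J^T = 0.
    by rewrite -[J^T](mulmxKV uM) -/covector_lift mulmxA vz mul0mx.
  move/(congr1 trmx); rewrite trmx_mul trmxK trmx0 => Jz.
  apply: trmx_inj; rewrite trmx0; apply: (row_full_inj J_full).
  by rewrite Jz mulmx0.
have uP : P \in unitmx.
  by rewrite -row_free_unit -kermx_eq0; apply/rowV0P => z /sub_kermxP /kP.
have GP : GB *m P = 1%:M.
  by apply: (can_inj (mulKmx uP)); rewrite mulmxA PGP mulmx1.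
have [_ uG] := mulmx1_unit (mulmx1C GP).
by rewrite -[P](mulKmx uG) GP mulmx1.
Qed.

End Submersion.

Section Trace.
Variables (m n k : nat) (GM : 'M[R]_m) (GB : 'M[R]_n) (J : 'M[R]_(m, n)).
Variables (E : 'M[R]_(k, m)).
Hypotheses (sM : GM^T = GM) (uM : GM \in unitmx).
Hypotheses (sB : GB^T = GB) (uB : GB \in unitmx).
Variable L : 'M[R]_(n, m).
Hypotheses (defL : L *m GM = J^T) (cometric : L *m J = invmx GB).
Hypotheses (freeE : row_free E) (kerE : (E == kermx J)%MS).

Let LT : L^T = invmx GM *m J.
Proof. by rewrite -[J]trmxK -defL trmx_mul sM mulKmx. Qed.

Let EJ : E *m J = 0.
Proof. by apply/sub_kermxP; rewrite (eqmxP kerE). Qed.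

(** What remains of the inverse of GM after removing its horizontal part
    L^T GB L is killed by J, hence factors through E, and pairing it with E
    identifies the factor as the inverse of the Gram matrix of E. *)
Lemma cometric_split :
  invmx GM = E^T *m invmx (gram GM E) *m E + L^T *m GB *m L.
Proof.
set V := invmx GM - L^T *m GB *m L.
have VJ : V *m J = 0.
  by rewrite /V mulmxBl -!mulmxA cometric mulmxV// mulmx1 LT subrr.
have /submxP[X VX] : (V <= E)%MS.
  by rewrite (eqmxP kerE); apply/sub_kermxP.
have VGE : V *m GM *m E^T = E^T.
  rewrite /V mulmxBl mulVmx// mulmxBl mul1mx.
  rewrite -!mulmxA (mulmxA L) defL -(trmx_mul E J) EJ.
  by rewrite trmx0 !mulmx0 subr0.
have XE : X *m gram GM E = E^T by rewrite -VGE VX /gram !mulmxA.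
have uE : gram GM E \in unitmx.
  have [Y EY] := row_freeP freeE.
  have : Y^T *m X *m gram GM E = 1%:M.
    by rewrite -mulmxA XE -trmx_mul EY trmx1.
  by case/mulmx1_unit.
rewrite -XE mulmxK// -VX /V subrK//.
Qed.

Variables (eps : R) (d : 'cV[R]_n).
Let hM := GM + eps *: (J *m d *m (J *m d)^T).
Let hB := GB + eps *: (d *m d^T).

Let hML : hM *m L^T = J *m hB *m invmx GB.
Proof.
have LTJ : J^T *m L^T = invmx GB.
  by rewrite -trmx_mul cometric (trmx_inv_sym sB).
rewrite /hM /hB mulmxDl mulmxDr mulmxDl mulmxK// {1}LT mulKVmx//.
congr (_ + _); rewrite -scalemxAl -scalemxAr -scalemxAl; congr (_ *: _).
by rewrite [(J *m d)^T]trmx_mul -!mulmxA LTJ.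
Qed.

Let hME : hM *m E^T = GM *m E^T.
Proof.
rewrite /hM mulmxDl -scalemxAl -mulmxA -trmx_mul (mulmxA E) EJ mul0mx trmx0.
by rewrite mulmx0 scaler0 addr0.
Qed.

(* The rank one term of hM is horizontal, so only the horizontal part of the
   cometric changes: GB becomes GB hB^-1 GB. *)
Let graph_gram_mul_inv : hB \in unitmx ->
  hM *m (E^T *m invmx (gram GM E) *m E
         + L^T *m (GB *m invmx hB *m GB) *m L) = 1%:M.
Proof.
move=> u; rewrite mulmxDr !mulmxA hML mulmxKV// mulmxK// hME.
have -> : J = GM *m L^T by rewrite LT mulKVmx.
by rewrite -!mulmxA -mulmxDr !mulmxA -cometric_split mulmxV.
Qed.

Lemma graph_gram_unit : (hM \in unitmx) = (hB \in unitmx).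
Proof.
apply/idP/idP => u; last by case/mulmx1_unit: (graph_gram_mul_inv u).
have : J^T *m invmx hM *m J *m hB = 1%:M.
  have uiB : invmx GB \in unitmx by rewrite unitmx_inv.
  apply: (can_inj (mulmxK uiB)).
  rewrite -!mulmxA (mulmxA J) -hML mul1mx mulKmx//.
  by rewrite -trmx_mul cometric (trmx_inv_sym sB).
by case/mulmx1_unit.
Qed.

Lemma graph_gram_inv : hB \in unitmx ->
  invmx hM = E^T *m invmx (gram GM E) *m E
             + L^T *m (GB *m invmx hB *m GB) *m L.
Proof.
move=> u; have uM' := u; rewrite -graph_gram_unit in uM'.
by apply: (can_inj (mulKmx uM')); rewrite mulmxV// graph_gram_mul_inv.
Qed.

(** The purely algebraic half of the theorem.  Here J H J^T + T stands for the
    Hessian of a function pulled back from the base, T being the contribution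
    of the second fundamental form of the projection: by the splitting of the
    inverse Gram matrix, its trace only sees T on pairs of horizontal vectors
    and the vertical trace of T. *)
Lemma graph_trace (H : 'M[R]_n) (T : 'M[R]_m) : hB \in unitmx ->
  L *m T *m L^T = 0 -> \tr (invmx (gram GM E) *m (E *m T *m E^T)^T) = 0 ->
  \tr (invmx hM *m (J *m H *m J^T + T)^T) = \tr (invmx hB *m H^T).
Proof.
move=> u LTL trE; rewrite linearD/= mulmxDr mxtraceD.
have -> : \tr (invmx hM *m T^T) = 0.
  rewrite graph_gram_inv// mulmxDl mxtraceD.
  rewrite -!mulmxA mxtrace_mulC -!mulmxA [X in _ + X]mxtrace_mulC -!mulmxA.
  have -> : L *m (T^T *m L^T) = (L *m T *m L^T)^T by rewrite !trmx_mul trmxK.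
  rewrite LTL trmx0 !mulmx0 mxtrace0 addr0 -[RHS]trE !trmx_mul trmxK.
  by rewrite !mulmxA.
rewrite addr0 graph_gram_inv// !trmx_mul trmxK.
have JL : J^T *m L^T = invmx GB.
  by rewrite -trmx_mul cometric (trmx_inv_sym sB).
rewrite mulmxDl -!mulmxA.
rewrite (mulmxA E J) EJ mul0mx !mulmx0 add0r (mulmxA L J) cometric mulKVmx//.
rewrite mxtrace_mulC -!mulmxA JL mxtrace_mulC -!mulmxA mulVmx// mulmx1//.
Qed.

End Trace.
End LinearAlgebra.

(** * Differential calculus of matrix-valued maps *)

Section Calculus.
Variable R : realType.

Section Germs.
Variables (V W : normedModType R).

Lemma near_eq_differentiable (f g : V -> W) x :
  (\forall y \near x, f y = g y) -> differentiable f x -> differentiable g x.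
Proof.
move=> fg df; have fgx : f x = g x by exact: nbhs_singleton fg.
have fg0 : \forall h \near (0 : V), f (h + x) = g (h + x).
  move: fg; rewrite (near_shift 0 x) /=.
  by apply: filterS => h /=; rewrite subr0.
have cdf := diff_continuous df.
have expand : g \o shift x = cst (g x) + 'd f x +o_ (0 : V) id.
  have /eqaddoP fo := diff_locally df.
  apply/eqaddoP => e e0; have := fo _ e0.
  move: fg0; apply: filterS2 => h; rewrite /= !fctE/= => ->.
  by rewrite fgx.
have dgE := diff_unique cdf expand.
by apply/diff_locallyP; rewrite dgE.
Qed.

Lemma open_near_eq (U : set V) (f g : V -> W) y :
  open U -> U y -> (forall z, U z -> f z = g z) -> \forall z \near y, f z = g z.
Proof. by move=> oU Uy fg; apply: filterS (open_nbhs_nbhs (conj oU Uy)). Qed.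

Lemma derive_linear (f : V -> W) y : differentiable f y ->
  linear (fun v => 'D_v f y).
Proof. by move=> df a v w; rewrite !deriveE// linearP. Qed.
End Germs.

Lemma derive_comp (U V W : normedModType R) (f : U -> V) (g : V -> W) y v :
  differentiable f y -> differentiable g (f y) ->
  'D_v (g \o f) y = 'D_('D_v f y) g (f y).
Proof.
move=> df dg; rewrite !deriveE//; first by rewrite diff_comp.
exact: differentiable_comp.
Qed.

Section Matrices.
Variables (V : normedModType R) (p q : nat).
Implicit Types f : V -> 'M[R]_(p, q).

Lemma differentiable_entry f x i j :
  differentiable f x -> differentiable (fun y => f y i j) x.
Proof.
move=> df; apply: (@differentiable_comp _ _ _ _ f (fun N => N i j)) => //.
exact: differentiable_coord.
Qed.

Lemma differentiable_mx f x :
  (forall i j, differentiable (fun y => f y i j) x) -> differentiable f x.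
Proof.
move=> df; have -> : f = \sum_(i < p) \sum_(j < q)
    (fun y => f y i j *: (delta_mx i j : 'M[R]_(p, q))).
  apply/funext => y; rewrite fct_sumE [LHS]matrix_sum_delta.
  by apply: eq_bigr => i _; rewrite fct_sumE.
apply: differentiable_sum => i; apply: differentiable_sum => j.
exact: differentiableZl.
Qed.

Lemma derive_entry f x v i j :
  differentiable f x -> ('D_v f x) i j = 'D_v (fun y => f y i j) x.
Proof. by move=> df; rewrite derive_mx ?mxE//; exact: diff_derivable. Qed.

Lemma continuous_mx f x :
  (forall i j, {for x, continuous (fun y => f y i j)}) ->
  {for x, continuous f}.
Proof.
move=> cf; apply/cvgrPdist_le => /= e e0.
near=> y; rewrite /Num.Def.normr/= mx_normrE (bigmax_le _ (ltW e0))//= => ij _.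
rewrite !mxE; move: ij; near: y; apply: filter_forall => /= ij.
exact: ((cvgrPdist_le _ _).1 (cf ij.1 ij.2)).
Unshelve. all: by end_near. Qed.

End Matrices.

Lemma differentiable_mulmx (V : normedModType R) p q r
    (A : V -> 'M[R]_(p, q)) (B : V -> 'M[R]_(q, r)) x :
  differentiable A x -> differentiable B x ->
  differentiable (fun y => A y *m B y) x.
Proof.
move=> dA dB; apply: differentiable_mx => i j.
under eq_fun do rewrite mxE.
rewrite (_ : (fun _ => _) = \sum_k (fun y => A y i k * B y k j)); last first.
  by apply/funext => y; rewrite fct_sumE.
by apply: differentiable_sum => k; apply: differentiableM;
  exact: differentiable_entry.
Qed.

Lemma derive_mulmx (V : normedModType R) p q r
    (A : V -> 'M[R]_(p, q)) (B : V -> 'M[R]_(q, r)) x v :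
  differentiable A x -> differentiable B x ->
  'D_v (fun y => A y *m B y) x = 'D_v A x *m B x + A x *m 'D_v B x.
Proof.
move=> dA dB; apply/matrixP => i j.
rewrite derive_entry; last exact: differentiable_mulmx.
under eq_fun do rewrite mxE.
rewrite (_ : (fun _ => _) = \sum_k (fun y => A y i k * B y k j)); last first.
  by apply/funext => y; rewrite fct_sumE.
have dAe i' j' : derivable (fun y => A y i' j') x v.
  by apply: diff_derivable; exact: differentiable_entry.
have dBe i' j' : derivable (fun y => B y i' j') x v.
  by apply: diff_derivable; exact: differentiable_entry.
rewrite derive_sum; last by move=> k; apply: derivableM.
rewrite !mxE -big_split; apply: eq_bigr => k _ /=.
by rewrite deriveM// addrC !derive_entry// mulrC; congr (_ + _); rewrite mulrC.
Qed.

Lemma derive_mulmxl (V : normedModType R) p q r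
    (C : 'M[R]_(p, q)) (B : V -> 'M[R]_(q, r)) x v :
  differentiable B x -> 'D_v (fun y => C *m B y) x = C *m 'D_v B x.
Proof.
move=> dB; rewrite (@derive_mulmx _ _ _ _ (fun=> C))//.
by rewrite derive_cst mul0mx add0r.
Qed.

Lemma derive_trmx (V : normedModType R) p q (A : V -> 'M[R]_(p, q)) x v :
  differentiable A x ->
  differentiable (fun y => (A y)^T) x /\
  'D_v (fun y => (A y)^T) x = ('D_v A x)^T.
Proof.
move=> dA; have dT : differentiable (fun y => (A y)^T) x.
  apply: differentiable_mx => i j; under eq_fun do rewrite mxE.
  exact: differentiable_entry.
split=> //; apply/matrixP => i j; rewrite mxE !derive_entry//.
by under eq_fun do rewrite mxE.
Qed.

Lemma row_jacobian m n (f : 'rV[R]_m -> 'rV[R]_n) y i :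
  differentiable f y -> row i ('J f y) = 'D_(delta_mx 0 i) f y.
Proof. by move=> df; rewrite rowE deriveEjacobian. Qed.

End Calculus.

(** * Maps of class C^k *)

Section CkTheory.
Variable R : realType.

Section General.
Variables (n : nat) (W : normedModType R).
Implicit Types (U V : set 'rV[R]_n) (f g : 'rV[R]_n -> W).

Lemma Ck_on_sub k U V f : V `<=` U -> Ck_on k U f -> Ck_on k V f.
Proof.
elim: k f => [|k IH] f VU /=; first by move=> cf y /VU /cf.
by case=> df Df; split=> [y /VU /df //|v]; exact: IH.
Qed.

Lemma Ck_on_ext k U f g : open U -> (forall y, U y -> f y = g y) ->
  Ck_on k U f -> Ck_on k U g.
Proof.
move=> oU; elim: k f g => [|k IH] f g fg /=.
  move=> cf y Uy; have fgy := open_near_eq oU Uy fg.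
  rewrite /prop_for /continuous_at -(fg _ Uy).
  by apply: cvg_trans (cf y Uy); exact: near_eq_cvg fgy.
case=> df Df; split=> [y Uy|v].
  exact: near_eq_differentiable (open_near_eq oU Uy fg) (df y Uy).
apply: (IH ('D_v f)) => // y Uy.
exact: near_eq_derive (open_near_eq oU Uy fg).
Qed.

Lemma Ck_onS k U f : Ck_on k.+1 U f -> Ck_on k U f.
Proof.
elim: k f => [|k IH] f; first by case=> df _ y /df /differentiable_continuous.
by case=> df Df; split=> // v; exact: IH.
Qed.

Lemma Ck_on_glue k U f :
  (forall y, U y -> exists2 V, V y & Ck_on k V f) -> Ck_on k U f.
Proof.
elim: k f => [|k IH] f loc; first by move=> y /loc[V Vy]; exact.
split=> [y /loc[V Vy [df _]]|v]; first exact: df.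
by apply: IH => y /loc[V Vy [_ Df]]; exists V => //; exact: Df.
Qed.

Lemma Ck_on_cst k U (c : W) : Ck_on k U (cst c).
Proof.
elim: k c => [|k IH] c; first by move=> y _; exact: cst_continuous.
split=> [y _|v]; first exact: differentiable_cst.
by rewrite (_ : (fun _ => _) = cst 0)//; apply/funext => y; rewrite derive_cst.
Qed.

Lemma Ck_onD k U f g : open U ->
  Ck_on k U f -> Ck_on k U g -> Ck_on k U (fun y => f y + g y).
Proof.
move=> oU; elim: k f g => [|k IH] f g.
  by move=> cf cg y Uy; apply: continuousD; [exact: cf|exact: cg].
move=> [df Df] [dg Dg]; split=> [y Uy|v].
  by apply: differentiableD; [exact: df|exact: dg].
apply: Ck_on_ext (IH _ _ (Df v) (Dg v)) => // y Uy.
by rewrite deriveD//; apply: diff_derivable; [exact: df|exact: dg].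
Qed.

Lemma Ck_on_sum k U (I : Type) (r : seq I) (P : pred I)
    (F : I -> 'rV[R]_n -> W) :
  open U -> (forall i, P i -> Ck_on k U (F i)) ->
  Ck_on k U (fun y => \sum_(i <- r | P i) F i y).
Proof.
move=> oU FC; elim: r => [|i r IH].
  by under eq_fun do rewrite big_nil; exact: Ck_on_cst.
under eq_fun do rewrite big_cons; case Pi: (P i) => //.
have FiC := FC _ Pi.
exact: Ck_onD.
Qed.

End General.

Section Scalar.
Variable n : nat.
Implicit Types (U : set 'rV[R]_n) (f g : 'rV[R]_n -> R).

Lemma Ck_onM k U f g : open U ->
  Ck_on k U f -> Ck_on k U g -> Ck_on k U (fun y => f y * g y).
Proof.
move=> oU; elim: k f g => [|k IH] f g.
  by move=> cf cg y Uy; apply: continuousM; [exact: cf|exact: cg].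
move=> fC gC; have [df Df] := fC; have [dg Dg] := gC; split=> [y Uy|v].
  by apply: differentiableM; [exact: df|exact: dg].
have FC : Ck_on k U (fun y => f y * 'D_v g y + g y * 'D_v f y).
  by apply: Ck_onD => //; apply: IH; solve [exact: Ck_onS|exact: Df|exact: Dg].
apply: Ck_on_ext FC => // y Uy.
by rewrite deriveM//; apply: diff_derivable; auto.
Qed.

Lemma Ck_on_prod k U (I : Type) (r : seq I) (P : pred I)
    (F : I -> 'rV[R]_n -> R) :
  open U -> (forall i, P i -> Ck_on k U (F i)) ->
  Ck_on k U (fun y => \prod_(i <- r | P i) F i y).
Proof.
move=> oU FC; elim: r => [|i r IH].
  by under eq_fun do rewrite big_nil; exact: Ck_on_cst.
under eq_fun do rewrite big_cons; case Pi: (P i) => //.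
have FiC := FC _ Pi.
exact: Ck_onM.
Qed.

End Scalar.

Section Matrix.
Variable n : nat.
Implicit Types (U : set 'rV[R]_n).

Lemma Ck_on_entry k U p q (f : 'rV[R]_n -> 'M[R]_(p, q)) i j : open U ->
  Ck_on k U f -> Ck_on k U (fun y => f y i j).
Proof.
move=> oU; elim: k f => [|k IH] f.
  move=> cf y Uy.
  apply: (@continuous_comp _ _ _ f (fun N : 'M[R]_(p, q) => N i j)).
    exact: cf.
  exact: coord_continuous.
move=> [df Df]; split=> [y Uy|v]; first exact/differentiable_entry/df.
by apply: Ck_on_ext (IH _ (Df v)) => // y Uy; rewrite derive_entry//; exact: df.
Qed.

Lemma Ck_on_mx k U p q (f : 'rV[R]_n -> 'M[R]_(p, q)) : open U ->
  (forall i j, Ck_on k U (fun y => f y i j)) -> Ck_on k U f.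
Proof.
move=> oU; elim: k f => [|k IH] f fC.
  by move=> y Uy; apply: continuous_mx => i j; exact: fC.
have df y : U y -> differentiable f y.
  by move=> Uy; apply: differentiable_mx => i j; have [+ _] := fC i j; exact.
split=> // v; apply: IH => i j; have [_ /(_ v)] := fC i j.
by apply: Ck_on_ext => // y Uy; rewrite derive_entry//; exact: df.
Qed.

Lemma Ck_on_mulmx k U p q r (A : 'rV[R]_n -> 'M[R]_(p, q))
    (B : 'rV[R]_n -> 'M[R]_(q, r)) : open U ->
  Ck_on k U A -> Ck_on k U B -> Ck_on k U (fun y => A y *m B y).
Proof.
move=> oU AC BC; apply: Ck_on_mx => // i j; under eq_fun do rewrite mxE.
by apply: Ck_on_sum => // l _; apply: Ck_onM => //; exact: Ck_on_entry.
Qed.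

Lemma Ck_on_det k U p (A : 'rV[R]_n -> 'M[R]_p) : open U ->
  Ck_on k U A -> Ck_on k U (fun y => \det (A y)).
Proof.
move=> oU AC; rewrite /determinant; apply: Ck_on_sum => // s _.
apply: Ck_onM => //; first exact: Ck_on_cst.
by apply: Ck_on_prod => // i _; exact: Ck_on_entry.
Qed.

(** The adjugate replaces the inverse wherever a smooth frame is needed: it is
    polynomial in the entries and defined everywhere. *)
Lemma Ck_on_adj k U p (A : 'rV[R]_n -> 'M[R]_p) : open U ->
  Ck_on k U A -> Ck_on k U (fun y => \adj (A y)).
Proof.
move=> oU AC; apply: Ck_on_mx => // i j; under eq_fun do rewrite mxE /cofactor.
apply: Ck_onM => //; first exact: Ck_on_cst.
apply: Ck_on_det => //; apply: Ck_on_mx => // i' j'.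
by under eq_fun do rewrite !mxE; exact: Ck_on_entry.
Qed.

Lemma Ck_on_comp k U p (V : set 'rV[R]_p)
   (f : 'rV[R]_n -> 'rV[R]_p) (g : 'rV[R]_p -> R) : open U ->
  (forall y, U y -> V (f y)) -> Ck_on k U f -> Ck_on k V g ->
  Ck_on k U (g \o f).
Proof.
move=> oU fUV; elim: k g => [|k IH] g fC gC.
  by move=> y Uy; apply: continuous_comp; [exact: fC|exact/gC/fUV].
have [df Df] := fC; have [dg Dg] := gC; split=> [y Uy|v].
  by apply: differentiable_comp; [exact: df|exact/dg/fUV].
have FC : Ck_on k U (fun y => \sum_(l < p)
    ('D_v f y) 0 l * (fun z => 'D_(delta_mx 0 l) g z) (f y)).
  apply: Ck_on_sum => // l _; apply: Ck_onM => //.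
    by apply: Ck_on_entry => //; exact: Df.
  by apply: (IH (fun z => 'D_(delta_mx 0 l) g z)); [exact: Ck_onS|exact: Dg].
apply: Ck_on_ext FC => // y Uy.
have dgy := dg _ (fUV _ Uy); have dfy := df _ Uy.
rewrite (derive_comp v dfy dgy) [in RHS](row_sum_delta ('D_v f y)).
rewrite [RHS]deriveE//.
rewrite linear_sum/=; apply: eq_bigr => l _.
by rewrite linearZ/= -deriveE.
Qed.

End Matrix.

Lemma jacobian_Ck m n k U (f : 'rV[R]_m -> 'rV[R]_n) : open U ->
  Ck_on k.+1 U f -> Ck_on k U (jacobian f).
Proof.
move=> oU [df Df]; apply: Ck_on_mx => // i j.
apply: Ck_on_ext (Ck_on_entry 0 j oU (Df (delta_mx 0 i))) => // y Uy.
by rewrite -row_jacobian ?mxE//; exact: df.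
Qed.

End CkTheory.

(** * Symmetry of second derivatives *)

Section Schwarz.
Variables (R : realType) (n : nat).
Implicit Types (U : set 'rV[R]_n) (f : 'rV[R]_n -> R) (y v w : 'rV[R]_n).

Lemma is_derive_line f y v (s : R) : differentiable f (y + s *: v) ->
  is_derive s 1 (fun t => f (y + t *: v)) ('D_v f (y + s *: v)).
Proof.
move=> df; have := @diff_derivable _ _ _ f _ v df; rewrite /derivable => dv.
have E : (fun h => h^-1 *: (((fun t => f (y + t *: v)) \o shift s) (h *: 1)
              - f (y + s *: v))) =
         (fun h => h^-1 *: ((f \o shift (y + s *: v)) (h *: v)
              - f (y + s *: v))).
  apply/funext => h /=; congr (_ *: (f _ - _)).
  by rewrite [h *: 1]mulr1 scalerDl addrCA.
by split; rewrite /derivable /derive E.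
Qed.

Lemma mean_value_line f y v (h : R) : 0 < h ->
  (forall s, 0 <= s <= h -> differentiable f (y + s *: v)) ->
  exists2 s, 0 <= s <= h & f (y + h *: v) - f y = h * 'D_v f (y + s *: v).
Proof.
move=> h0 df.
have D s : 0 <= s <= h -> is_derive s 1 (fun t => f (y + t *: v))
             ('D_v f (y + s *: v)) by move=> /df /is_derive_line.
have [s|s|s sI] := @MVT _ (fun t => f (y + t *: v))
                   (fun s => 'D_v f (y + s *: v)) 0 h h0.
- by rewrite in_itv/= => /andP[s0 sh]; apply: D; rewrite !ltW.
- apply: continuous_in_subspaceT s => s; rewrite inE/= in_itv/= => sI.
  by apply/differentiable_continuous/derivable1_diffP; case: (D s sI).
- move=> E; exists s.
    by move: sI; rewrite in_itv/= => /andP[??]; rewrite !ltW.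
  by move: E; rewrite scale0r addr0 subr0 mulrC.
Qed.

(** Two applications of the mean value theorem: first along v to the function
    z |-> f (z + h w) - f z, then along w to 'D_v f. *)
Lemma second_difference U f y v w (h : R) : open U -> 0 < h -> Ck_on 2 U f ->
  (forall s t, 0 <= s <= h -> 0 <= t <= h -> U (y + s *: v + t *: w)) ->
  exists s t, [/\ 0 <= s <= h, 0 <= t <= h &
    f (y + h *: v + h *: w) - f (y + h *: v) - (f (y + h *: w) - f y)
    = h * (h * 'D_w ('D_v f) (y + s *: v + t *: w))].
Proof.
move=> oU h0 [df Df] Ust; have hh : 0 <= h <= h by rewrite lexx ltW.
have h00 : (0 : R) <= 0 <= h by apply/andP; split => //; exact: ltW.
pose sh (z : 'rV[R]_n) := z + h *: w.
pose g := (f \o sh) - f.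
have dsh z : differentiable sh z.
  by apply: differentiableD => //; exact: differentiable_cst.
have Dsh z : 'D_v sh z = v.
  rewrite deriveD; [|exact: derivable_id|exact: derivable_cst].
  by rewrite derive_id derive_cst addr0.
have dg s : 0 <= s <= h -> differentiable g (y + s *: v) /\
   'D_v g (y + s *: v) = 'D_v f (y + s *: v + h *: w) - 'D_v f (y + s *: v).
  move=> sI; have dy : differentiable f (y + s *: v).
    by apply: df; have := Ust s 0 sI h00; rewrite scale0r addr0.
  have dyw : differentiable f (sh (y + s *: v)) by exact/df/Ust.
  have dfs : differentiable (f \o sh) (y + s *: v).
    exact: differentiable_comp.
  split; first exact: differentiableB.
  rewrite deriveB; [|exact: diff_derivable..].
  by rewrite (derive_comp v (dsh _) dyw) Dsh.
have [s sh1 E] := mean_value_line h0 (fun s sh => (dg s sh).1).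
have [t th E'] := @mean_value_line ('D_v f) (y + s *: v) w h h0
   (fun t th => (Df v).1 _ (Ust s t sh1 th)).
exists s, t; split => //; rewrite -E' -(dg s sh1).2 -E /g/= !fctE /sh.
by rewrite addrAC.
Qed.

Let second_difference_eq (h a b c d A B : R) : 0 < h ->
  a - b - (c - d) = h * (h * A) -> a - c - (b - d) = h * (h * B) -> A = B.
Proof.
move=> h0 EA EB; have hn : h != 0 by rewrite gt_eqF.
apply: (mulfI hn); apply: (mulfI hn); rewrite -EA -EB.
by rewrite !opprB !addrA [a - b + d]addrAC [a - c + d]addrAC [RHS]addrAC.
Qed.

Let dist_of_nearby (A B A' B' e : R) :
  `|A - A'| < e / 2 -> `|B - B'| < e / 2 -> A' = B' -> `|A - B| <= e.
Proof.
move=> HA HB AB; rewrite (le_trans (ler_distD A' _ _))// [leRHS]splitr.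
by rewrite lerD// ?ltW// distrC AB.
Qed.

(** The second difference of f on a small parallelogram does not depend on the
    order of its sides, so the two mixed derivatives take a common value,
    after division by h^2, at points arbitrarily close to y; both are
    continuous. *)
Theorem derive_comm U f y v w : open U -> U y -> Ck_on 2 U f ->
  'D_v ('D_w f) y = 'D_w ('D_v f) y.
Proof.
move=> oU Uy fC; have [_ Df] := fC.
have [_ /(_ w) cA] := Df v; have [_ /(_ v) cB] := Df w.
apply/eqP; rewrite -subr_eq0 -normr_le0.
apply/ler_addgt0Pl => e e0; rewrite addr0.
have e20 : 0 < e / 2 by rewrite divr_gt0.
have := (cvgrPdist_lt _ _).1 (cA y Uy) _ e20.
have := (cvgrPdist_lt _ _).1 (cB y Uy) _ e20.
have UU : \forall z \near y, U z by exact: open_nbhs_nbhs.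
move=> nB nA.
pose near_y := U `&` ([set z | `|'D_w ('D_v f) y - 'D_w ('D_v f) z| < e / 2] `&`
                      [set z | `|'D_v ('D_w f) y - 'D_v ('D_w f) z| < e / 2]).
have /nbhs_ballP[d /= d0 dP] : nbhs y near_y.
  by apply: filterI => //; apply: filterI; [exact: nA|exact: nB].
have [h h0 hP] : exists2 h, 0 < h & forall s t, 0 <= s <= h -> 0 <= t <= h ->
   ball y d (y + s *: v + t *: w).
  exists (d / (2 * (`|v| + `|w| + 1))) => [|s t /andP[s0 sh] /andP[t0 th]].
    by rewrite divr_gt0// mulr_gt0// ltr_wpDl// addr_ge0.
  rewrite -ball_normE/= -addrA opprD addNKr normrN.
  set S := `|v| + `|w| in sh th *.
  have S0 : 0 <= S by rewrite addr_ge0.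
  set h := d / _ in sh th; have hS : h * (S + 1) = d / 2.
    by rewrite /h invfM mulrA mulfVK// gt_eqF// ltr_wpDl.
  rewrite (@le_lt_trans _ _ (h * S))//.
    rewrite (le_trans (ler_normD _ _))// !normrZ !ger0_norm// mulrDr.
    by rewrite lerD// ler_wpM2r.
  have h0 : 0 <= h by exact: le_trans s0 sh.
  rewrite (@le_lt_trans _ _ (d / 2))//; last first.
    by rewrite ltr_pdivrMr// ltr_pMr// ltr1n.
  by rewrite -hS ler_wpM2l// lerDl.
have [s [t [sh th E]]] := @second_difference U f y v w h oU h0 fC
  (fun s t sh th => (dP _ (hP s t sh th)).1).
have [|s' [t' [sh' th' E']]] := @second_difference U f y w v h oU h0 fC.
  by move=> s' t' sh' th'; rewrite addrAC; have [] := dP _ (hP _ _ th' sh').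
have [_ [Hs _]] := dP _ (hP s t sh th).
have [_ [_ Hs']] : near_y (y + s' *: w + t' *: v).
  by apply: dP; rewrite addrAC; exact: hP.
rewrite [y + h *: w + h *: v]addrAC in E'.
have EE : 'D_w ('D_v f) (y + s *: v + t *: w)
        = 'D_v ('D_w f) (y + s' *: w + t' *: v).
  exact: second_difference_eq h0 E E'.
exact: dist_of_nearby Hs' Hs (esym EE).
Qed.

End Schwarz.

(** * Christoffel symbols *)

Section Koszul.
Variables (R : realType) (n : nat) (G : 'M[R]_n) (D : 'rV[R]_n -> 'M[R]_n).
Hypotheses (uG : G \in unitmx) (sG : G^T = G).
Hypothesis Dlin : forall a v w, D (a *: v + w) = a *: D v + D w.
Hypothesis Dsym : forall v, (D v)^T = D v.

(** The Christoffel symbols of a metric with value G and first derivatives D at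
    a point.  Their algebraic properties are those of the Koszul formula for an
    arbitrary linear family D of symmetric matrices. *)
Definition koszul (v w : 'rV[R]_n) : 'rV[R]_n :=
  2^-1 *: (\row_s (form (D v) w (basis_vec R s) + form (D w) v (basis_vec R s)
                   - form (D (basis_vec R s)) v w) *m invmx G).

Lemma koszulE v w s : form G (koszul v w) s =
  2^-1 * (form (D v) w s + form (D w) v s - form (D s) v w).
Proof.
rewrite /koszul /Defs.form -scalemxAl mulmxKV// -scalemxAl mxE; congr (_ * _).
rewrite (@scalar_row _ _ (fun s => form (D v) w s + form (D w) v s
                               - form (D s) v w)) // => a s1 s2.
by rewrite Dlin form_addm form_scalem !form_addr !form_scaler; ring.
Qed.

Lemma koszulC v w : koszul v w = koszul w v.
Proof.
apply: (form_nondeg uG) => s; rewrite !koszulE; congr (_ * _).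
by rewrite (form_sym v w (Dsym s)) [form _ w s + _]addrC.
Qed.

Lemma koszul_linearr a v w w' :
  koszul v (a *: w + w') = a *: koszul v w + koszul v w'.
Proof.
apply: (form_nondeg uG) => s; rewrite form_addl form_scalel !koszulE.
rewrite Dlin form_addm form_scalem !form_addl !form_scalel.
rewrite form_addr form_scaler.
by ring.
Qed.

Lemma koszul_linearl a v v' w :
  koszul (a *: v + v') w = a *: koszul v w + koszul v' w.
Proof. by rewrite koszulC koszul_linearr !(koszulC w). Qed.

Lemma koszul_compat v a b :
  form (D v) a b = form G (koszul v a) b + form G a (koszul v b).
Proof.
rewrite (form_sym a (koszul v b) sG) !koszulE (form_sym b a (Dsym v)).
by field.
Qed.

End Koszul.

Section Christoffel.
Variables (R : realType) (n : nat) (g : 'rV[R]_n -> 'M[R]_n) (y : 'rV[R]_n).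
Hypotheses (dg : differentiable g y) (gy : g y \in unitmx).
Hypothesis gsym : \forall z \near y, (g z)^T = g z.

Let Dlin a v w : 'D_(a *: v + w) g y = a *: 'D_v g y + 'D_w g y.
Proof. exact: derive_linear. Qed.

Let Dsym v : ('D_v g y)^T = 'D_v g y.
Proof. by have [_ <-] := derive_trmx v dg; exact: near_eq_derive. Qed.

Lemma christoffel_sym v w : christoffel g y v w = christoffel g y w v.
Proof. exact: (koszulC gy Dlin Dsym). Qed.

Lemma christoffel_linearr a v w w' : christoffel g y v (a *: w + w') =
  a *: christoffel g y v w + christoffel g y v w'.
Proof. exact: (koszul_linearr gy Dlin). Qed.

Lemma christoffel_linearl a v v' w : christoffel g y (a *: v + v') w =
  a *: christoffel g y v w + christoffel g y v' w.
Proof. exact: (koszul_linearl gy Dlin Dsym). Qed.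

Lemma metric_compat v a b : form ('D_v g y) a b =
  form (g y) (christoffel g y v a) b + form (g y) a (christoffel g y v b).
Proof.
have sg : (g y)^T = g y by exact: nbhs_singleton gsym.
exact: (koszul_compat gy sg Dlin Dsym).
Qed.

End Christoffel.

(** * The soliton equation of a graph *)

Section Hessian.
Variables (R : realType) (n : nat).

Definition grad (w : 'rV[R]_n -> R) (y : 'rV[R]_n) : 'cV[R]_n :=
  \col_a 'D_(basis_vec R a) w y.

(** The covariant Hessian of w at y, as a function of two tangent vectors. *)
Definition hess_form (g : 'rV[R]_n -> 'M[R]_n) (w : 'rV[R]_n -> R)
    (y x v : 'rV[R]_n) : R :=
  'D_x ('D_v w) y - (christoffel g y x v *m grad w y) 0 0.

Definition hess g w y : 'M[R]_n :=
  \matrix_(a, b) hess_form g w y (basis_vec R a) (basis_vec R b).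

Lemma derive_grad w y v : differentiable w y -> 'D_v w y = (v *m grad w y) 0 0.
Proof.
move=> dw; rewrite mxE [in LHS](row_sum_delta v) deriveE// linear_sum.
by apply: eq_bigr => a _; rewrite linearZ/= -deriveE// mxE.
Qed.

End Hessian.

Lemma derive_scale (R : realType) (V W : normedModType R) (k : V -> R) (c : W)
    x v : differentiable k x -> 'D_v (fun z => k z *: c) x = 'D_v k x *: c.
Proof.
by move=> dk; rewrite !deriveE//; [rewrite diffZl|exact: differentiableZl].
Qed.

Lemma normal_part_linear (R : realType) k N (G : 'M[R]_N) (E : 'M[R]_(k, N))
    a u v :
  normal_part G E (a *: u + v) = a *: normal_part G E u + normal_part G E v.
Proof.
by rewrite /normal_part !mulmxDl -!scalemxAl scalerBr opprD addrACA.
Qed.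

Lemma normal_part_tangent (R : realType) k N (G : 'M[R]_N) (E : 'M[R]_(k, N))
    (u : 'rV[R]_k) :
  gram G E \in unitmx -> normal_part G E (u *m E) = 0.
Proof.
move=> uE; rewrite /normal_part.
have -> : u *m E *m G *m E^T = u *m gram G E by rewrite /gram !mulmxA.
by rewrite mulmxK// subrr.
Qed.

Section ProductMetric.
Variables (R : realType) (n : nat).

Let I : 'M[R]_(n, n + 1) := row_mx 1%:M 0.
Let dt : 'rV[R]_(n + 1) := row_mx 0 1%:M.

Let IIT : I *m I^T = 1%:M.
Proof. by rewrite tr_row_mx mul_row_col trmx1 trmx0 mulmx1 mulmx0 addr0. Qed.
Let dtIT : dt *m I^T = 0.
Proof. by rewrite tr_row_mx mul_row_col trmx1 trmx0 mulmx1 mulmx0 addr0. Qed.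
Let IdtT : I *m dt^T = 0.
Proof. by rewrite tr_row_mx mul_row_col trmx1 trmx0 mulmx1 mulmx0 addr0. Qed.
Let dtdtT : dt *m dt^T = 1%:M.
Proof. by rewrite tr_row_mx mul_row_col trmx1 trmx0 mulmx1 mulmx0 add0r. Qed.
Let ITI : I^T *m I + dt^T *m dt = 1%:M.
Proof.
rewrite !tr_row_mx !mul_col_row !trmx1 !trmx0 !mulmx1 !mul1mx ?mulmx0 ?mul0mx.
by rewrite add_block_mx !addr0 !add0r -scalar_mx_block.
Qed.

Variables (g : 'rV[R]_n -> 'M[R]_n) (eps : R).

Definition product_metric (z : 'rV[R]_(n + 1)) : 'M[R]_(n + 1) :=
  block_mx (g (lsubmx z)) 0 0 eps%:M.
Local Notation G := product_metric.

Let lsubI (z : 'rV[R]_(n + 1)) : lsubmx z = z *m I^T.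
Proof.
rewrite -[in RHS](hsubmxK z) tr_row_mx mul_row_col trmx1 trmx0 mulmx1.
by rewrite mulmx0 addr0.
Qed.

Let GE z : G z = I^T *m g (z *m I^T) *m I + eps *: (dt^T *m dt).
Proof.
rewrite /G lsubI !tr_row_mx mul_col_mx !mul_col_row scale_block_mx.
rewrite !trmx1 !trmx0 !mulmx1 !mul1mx ?mulmx0 ?mul0mx ?mulmx1 !scaler0.
by rewrite add_block_mx !addr0 !add0r scalemx1.
Qed.

Section At.
Variable p : 'rV[R]_(n + 1).
Let y := p *m I^T.
Hypothesis dg : differentiable g y.

Lemma differentiable_product_metric : differentiable G p.
Proof.
rewrite (_ : G =
    (fun z => I^T *m g (z *m I^T) *m I) + cst (eps *: (dt^T *m dt))).
  apply: differentiableD; last exact: differentiable_cst.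
  apply: differentiable_mulmx => //; apply: differentiable_mulmx => //.
  apply: (@differentiable_comp _ _ _ _ (fun z => z *m I^T)) => //.
  exact: differentiable_mulmx.
by apply/funext => z; rewrite GE.
Qed.

Lemma derive_product_metric V :
  'D_V G p = I^T *m 'D_(V *m I^T) g y *m I.
Proof.
rewrite (_ : G =
    (fun z => I^T *m g (z *m I^T) *m I) + cst (eps *: (dt^T *m dt)));
  last by apply/funext => z; rewrite GE.
have dI : differentiable (fun z : 'rV[R]_(n + 1) => z *m I^T) p.
  exact: differentiable_mulmx.
have DI : 'D_V (fun z : 'rV[R]_(n + 1) => z *m I^T) p = V *m I^T.
  rewrite (@derive_mulmx _ _ _ _ _ id (fun=> I^T))//.
  by rewrite derive_id derive_cst mulmx0 addr0.
have dgI : differentiable (fun z => g (z *m I^T)) p.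
  exact: (@differentiable_comp _ _ _ _ (fun z => z *m I^T)).
have dIg : differentiable (fun z => I^T *m g (z *m I^T)) p.
  exact: differentiable_mulmx.
rewrite deriveD; last first.
- exact: derivable_cst.
- by apply: diff_derivable; exact: differentiable_mulmx.
rewrite derive_cst addr0 (derive_mulmx (B := fun=> I))//.
rewrite derive_cst mulmx0 addr0.
have -> : 'D_V (fun z => I^T *m g (z *m I^T)) p =
    I^T *m 'D_V (fun z => g (z *m I^T)) p by exact: derive_mulmxl.
have -> // : 'D_V (fun z => g (z *m I^T)) p = 'D_(V *m I^T) g y.
by rewrite -DI; exact: (derive_comp V dI dg).
Qed.

Hypotheses (ug : g y \in unitmx) (eps0 : eps != 0).

Lemma product_metric_unit : G p \in unitmx.
Proof.
have : G p *m (I^T *m invmx (g y) *m I + eps^-1 *: (dt^T *m dt)) = 1%:M.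
  rewrite GE -/y mulmxDl !mulmxDr -!scalemxAl -!scalemxAr scalerA mulfV//.
  rewrite scale1r.
  rewrite -!mulmxA (mulmxA I I^T) IIT mul1mx (mulmxA I dt^T) IdtT mul0mx.
  rewrite (mulmxA dt I^T) dtIT mul0mx !mulmx0 (mulmxA dt dt^T) dtdtT mul1mx.
  by rewrite !scaler0 addr0 add0r mulKVmx// ITI.
by case/mulmx1_unit.
Qed.

(** The Levi-Civita connection of a product with a line: the line direction is
    parallel and orthogonal to the rest. *)
Lemma christoffel_product V W :
  christoffel G p V W = christoffel g y (V *m I^T) (W *m I^T) *m I.
Proof.
have Dlin a v w : 'D_(a *: v + w) G p = a *: 'D_v G p + 'D_w G p.
  exact/derive_linear/differentiable_product_metric.
have Dlin' a v w : 'D_(a *: v + w) g y = a *: 'D_v g y + 'D_w g y.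
  exact: derive_linear.
have fI (A : 'M[R]_n) a b :
    form (I^T *m A *m I) a b = form A (a *m I^T) (b *m I^T).
  by rewrite /Defs.form trmx_mul trmxK !mulmxA.
apply: (form_nondeg product_metric_unit) => s.
have -> : form (G p) (christoffel g y (V *m I^T) (W *m I^T) *m I) s =
    form (g y) (christoffel g y (V *m I^T) (W *m I^T)) (s *m I^T).
  set X := christoffel _ _ _ _.
  have X0 : form (dt^T *m dt) (X *m I) s = 0.
    by rewrite /Defs.form !mulmxA -(mulmxA X) IdtT mulmx0 !mul0mx mxE.
  rewrite GE -/y form_addm fI form_scalem X0 mulr0 addr0.
  by rewrite -(mulmxA X) IIT mulmx1.
rewrite [LHS](koszulE product_metric_unit Dlin).
have DG v a b : form ('D_v G p) a b
    = form ('D_(v *m I^T) g y) (a *m I^T) (b *m I^T).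
  by rewrite derive_product_metric fI.
by rewrite [RHS](koszulE ug Dlin'); congr (_ * (_ + _ - _)); exact: DG.
Qed.

End At.

Section Graph.
Variables (w : 'rV[R]_n -> R) (U : set 'rV[R]_n).
Variables (F : 'rV[R]_n -> 'rV[R]_(n + 1)) (y : 'rV[R]_n).
Hypotheses (oU : open U) (Uy : U y) (wC : Ck_on 2 U w).
Hypothesis FE : forall z, U z -> F z = row_mx z (w z)%:M.
Hypotheses (dg : differentiable g y) (ug : g y \in unitmx) (eps0 : eps != 0).

Let h := g y + eps *: (grad w y *m (grad w y)^T).
Let E := 'J F y.

Let FE' z : U z -> F z = z *m I + w z *: dt.
Proof.
move=> Uz; rewrite FE// /I /dt mul_mx_row mulmx1 mulmx0 scale_row_mx scaler0.
by rewrite add_row_mx addr0 add0r scalemx1.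
Qed.

Let dw z : U z -> differentiable w z.
Proof. by case: wC => + _; exact. Qed.

Let dF' z : U z -> differentiable (fun z => z *m I + w z *: dt) z.
Proof.
move=> Uz; apply: differentiableD; first exact: differentiable_mulmx.
exact/differentiableZl/dw.
Qed.

Let dF z : U z -> differentiable F z.
Proof.
move=> Uz; apply: near_eq_differentiable (dF' Uz).
by apply: open_near_eq oU Uz _ => z' Uz'; rewrite FE'.
Qed.

Let DF z v : U z -> 'D_v F z = v *m I + 'D_v w z *: dt.
Proof.
move=> Uz; rewrite (near_eq_derive v (open_near_eq oU Uz FE')).
have dI : differentiable (fun z : 'rV[R]_n => z *m I) z.
  exact: differentiable_mulmx.
rewrite deriveD; [|exact: diff_derivable|]; last first.
  exact/diff_derivable/differentiableZl/dw.
rewrite derive_scale; last exact: dw.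
rewrite (@derive_mulmx _ _ _ _ _ id (fun=> I))//.
by rewrite derive_id derive_cst mulmx0 addr0.
Qed.

Let EE : E = I + grad w y *m dt.
Proof.
apply/row_matrixP => a; rewrite row_jacobian; last exact: dF.
rewrite DF// [in RHS]linearD/= !rowE; congr (_ + _).
rewrite mulmxA [_ *m grad w y]mx11_scalar mul_scalar_mx; congr (_ *: _).
by rewrite -derive_grad//; exact: dw.
Qed.

Let Fy : F y *m I^T = y.
Proof.
by rewrite FE'// mulmxDl -mulmxA IIT mulmx1 -scalemxAl dtIT scaler0 addr0.
Qed.

Let dgF : differentiable g (F y *m I^T). Proof. by rewrite Fy. Qed.
Let ugF : g (F y *m I^T) \in unitmx. Proof. by rewrite Fy. Qed.

Let gramE : gram (G (F y)) E = h.
Proof.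
have IG : I *m G (F y) = g y *m I.
  rewrite GE Fy mulmxDr -scalemxAr !mulmxA IIT mul1mx IdtT mul0mx scaler0.
  by rewrite addr0.
have dtG : dt *m G (F y) = eps *: dt.
  rewrite GE Fy mulmxDr -scalemxAr !mulmxA dtIT !mul0mx add0r dtdtT.
  by rewrite mul1mx.
have ET : E^T = I^T + dt^T *m (grad w y)^T.
  by rewrite EE linearD/= trmx_mul.
rewrite /gram ET mulmxDr EE mulmxDl IG -mulmxA dtG !mulmxDl.
rewrite -!scalemxAr -!scalemxAl -!mulmxA IIT dtIT !mulmxA.
rewrite -(mulmxA (g y)) IdtT -(mulmxA (grad w y)) dtdtT.
by rewrite mulmx1 !mulmx0 mul0mx scaler0 addr0 add0r mulmx1.
Qed.

(* The part of the acceleration along the base is the Christoffel term.  Lifting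
   it to the tangent space of the graph costs a multiple of dt, which turns the
   second derivative of w into the covariant Hessian. *)
Let acceleration a b :
  cov_deriv G F (fun z => 'D_(basis_vec R b) F z) (basis_vec R a) y =
  hess g w y a b *: dt
  + christoffel g y (basis_vec R a) (basis_vec R b) *m E.
Proof.
rewrite /cov_deriv christoffel_product// Fy.
have -> : 'D_(basis_vec R a) (fun z => 'D_(basis_vec R b) F z) y
    = 'D_(basis_vec R a) ('D_(basis_vec R b) w) y *: dt.
  have nE := open_near_eq oU Uy (fun z Uz => DF (basis_vec R b) Uz).
  rewrite (near_eq_derive _ nE).
  have dDw : differentiable (fun z => 'D_(basis_vec R b) w z) y.
    by case: wC => _ /(_ (basis_vec R b))[+ _]; exact.
  rewrite deriveD; [|exact: derivable_cst|]; last first.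
    exact/diff_derivable/differentiableZl.
  by rewrite derive_cst add0r derive_scale.
have DFI v : 'D_v F y *m I^T = v.
  by rewrite DF// mulmxDl -mulmxA IIT mulmx1 -scalemxAl dtIT scaler0 addr0.
rewrite (DFI (basis_vec R a)) (DFI (basis_vec R b)) EE mulmxDr mulmxA.
set c := christoffel _ _ _ _.
rewrite [c *m grad w y]mx11_scalar mul_scalar_mx mxE /hess_form.
by rewrite scalerBl addrA addrAC subrK.
Qed.

(** Up to tangent vectors the acceleration of the graph is the Hessian of w
    times dt, so the mean curvature vector is the h-trace of the Hessian times
    the normal part of dt; and the latter is not 0, because dt is not tangent to
    a graph. *)
Lemma graph_soliton_eq :
  (gram (G (F y)) E \in unitmx /\
   mean_curvature (G (F y)) E
     (fun a b => cov_deriv G F (fun z => 'D_(basis_vec R b) F z)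
                           (basis_vec R a) y)
   = normal_part (G (F y)) E dt) <->
  (h \in unitmx /\ \tr (invmx h *m (hess g w y)^T) = 1).
Proof.
rewrite gramE.
suff mcE : h \in unitmx -> mean_curvature (G (F y)) E
     (fun a b => cov_deriv G F (fun z => 'D_(basis_vec R b) F z)
                           (basis_vec R a) y) =
     \tr (invmx h *m (hess g w y)^T) *: normal_part (G (F y)) E dt.
  split=> -[uh]; rewrite mcE// => H; split=> //; last by rewrite H scale1r.
  apply/eqP; rewrite -subr_eq0; apply: contraT => tr0.
  move/eqP: H; rewrite -subr_eq0 -[X in _ - X]scale1r -scalerBl scaler_eq0.
  rewrite (negPf tr0)/= /normal_part subr_eq0; set c := _ *m invmx _.
  move=> /eqP dtE; have := congr1 (mulmx^~ I^T) dtE.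
  rewrite dtIT EE -mulmxA mulmxDl IIT -mulmxA dtIT mulmx0 addr0 mulmx1 => c0.
  move: dtdtT; rewrite [in X in X *m _]dtE -c0 !mul0mx => /matrixP/(_ 0 0).
  by rewrite !mxE => /eqP; rewrite eq_sym oner_eq0.
move=> uh; rewrite /mean_curvature gramE /mxtrace.
rewrite scaler_suml; apply: eq_bigr => a _; rewrite mxE scaler_suml.
apply: eq_bigr => b _; rewrite acceleration normal_part_linear.
rewrite normal_part_tangent ?gramE//.
by rewrite addr0 scalerA [X in _ = (_ * X) *: _]mxE.
Qed.

End Graph.
End ProductMetric.

(** * The Hessian of a composite and the second fundamental form of a map *)

Section HessianBilinear.
Variables (R : realType) (n : nat) (g : 'rV[R]_n -> 'M[R]_n).
Variables (w : 'rV[R]_n -> R) (U : set 'rV[R]_n) (y : 'rV[R]_n).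
Hypotheses (oU : open U) (Uy : U y) (wC : Ck_on 2 U w).
Hypotheses (dg : differentiable g y) (gy : g y \in unitmx).
Hypothesis gsym : \forall z \near y, (g z)^T = g z.

Let dDw v : differentiable (fun z => 'D_v w z) y.
Proof. by case: wC => _ /(_ v)[+ _]; exact. Qed.

Let linB (a p q p' q' : R) :
  a * p + p' - (a * q + q') = a * (p - q) + (p' - q').
Proof. by rewrite mulrBr opprD addrACA. Qed.

Lemma hess_formE x v : hess_form g w y x v = form (hess g w y) x v.
Proof.
apply: bilinear_mx => [a x1 x2 v'|a x' v1 v2]; rewrite /hess_form.
  rewrite (derive_linear (dDw v')) (christoffel_linearl dg gy gsym).
  rewrite mulmxDl -scalemxAl !mxE.
  exact: linB.
rewrite (christoffel_linearr dg gy) mulmxDl -scalemxAl.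
have -> : 'D_x' ('D_(a *: v1 + v2) w) y =
    a * 'D_x' ('D_v1 w) y + 'D_x' ('D_v2 w) y.
  have E z : U z -> 'D_(a *: v1 + v2) w z = a * 'D_v1 w z + 'D_v2 w z.
    by move=> Uz; rewrite derive_linear//; case: wC => + _; exact.
  rewrite (near_eq_derive _ (open_near_eq oU Uy E)).
  have dZ : differentiable (fun z => a *: 'D_v1 w z) y.
    exact: differentiableZ.
  rewrite deriveD; [|exact: diff_derivable..].
  by rewrite deriveZ//; exact: diff_derivable.
rewrite !mxE; exact: linB.
Qed.

End HessianBilinear.

Lemma grad_comp (R : realType) m n (f : 'rV[R]_m -> 'rV[R]_n)
    (w : 'rV[R]_n -> R) y : differentiable f y -> differentiable w (f y) ->
  grad (w \o f) y = 'J f y *m grad w (f y).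
Proof.
move=> df dw; apply/colP => a; rewrite mxE (derive_comp _ df dw) derive_grad//.
by rewrite deriveEjacobian// -mulmxA -rowE !mxE.
Qed.

Section LocalMap.
Variables (R : realType) (m n : nat).
Variables (gM : 'rV[R]_m -> 'M[R]_m) (gB : 'rV[R]_n -> 'M[R]_n).
Variables (f : 'rV[R]_m -> 'rV[R]_n).

(** The second fundamental form of the map f, that is, the covariant derivative
    of its differential. *)
Definition map_second_form (y x v : 'rV[R]_m) : 'rV[R]_n :=
  'D_x ('D_v f) y + christoffel gB (f y) ('D_x f y) ('D_v f y)
  - christoffel gM y x v *m 'J f y.
Local Notation S := map_second_form.

Variables (U : set 'rV[R]_m) (V : set 'rV[R]_n).
Hypotheses (oU : open U) (oV : open V) (fUV : forall z, U z -> V (f z)).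
Hypothesis fC : Ck_on 2 U f.
Hypotheses (dM : forall z, U z -> differentiable gM z)
  (sM : forall z, U z -> (gM z)^T = gM z)
  (uM : forall z, U z -> gM z \in unitmx).
Hypotheses (dB : forall z, V z -> differentiable gB z)
  (sB : forall z, V z -> (gB z)^T = gB z)
  (uB : forall z, V z -> gB z \in unitmx).

Let df z : U z -> differentiable f z.
Proof. by case: fC => + _; exact. Qed.

Let dJ z : U z -> differentiable (jacobian f) z.
Proof. by have [+ _] := jacobian_Ck oU fC; exact. Qed.

Section AtPoint.
Variable y : 'rV[R]_m.
Hypothesis Uy : U y.
Let J := 'J f y.

Let gsymM : \forall z \near y, (gM z)^T = gM z.
Proof. exact: open_near_eq oU Uy sM. Qed.
Let gsymB : \forall z \near f y, (gB z)^T = gB z.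
Proof. exact: open_near_eq oV (fUV Uy) sB. Qed.

Let DDf x v : 'D_x ('D_v f) y = v *m 'D_x (jacobian f) y.
Proof.
have E z : U z -> 'D_v f z = v *m jacobian f z.
  by move=> Uz; rewrite deriveEjacobian//; exact: df.
rewrite (near_eq_derive _ (open_near_eq oU Uy E)).
exact: derive_mulmxl (dJ Uy).
Qed.

Lemma map_second_formE x v : S y x v = v *m 'D_x (jacobian f) y
  + christoffel gB (f y) (x *m J) (v *m J) - christoffel gM y x v *m J.
Proof. by rewrite /S DDf !deriveEjacobian//; exact: df. Qed.

Lemma map_second_form_sym x v : S y x v = S y v x.
Proof.
have cong (a a' b b' : 'rV[R]_n) (c c' : 'rV[R]_m) (K : 'M[R]_(m, n)) :
    a = a' -> b = b' -> c = c' -> a + b - c *m K = a' + b' - c' *m K.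
  by move=> -> -> ->.
apply: cong; last 2 first.
- exact: (christoffel_sym (dB (fUV Uy)) (uB (fUV Uy)) gsymB).
- exact: (christoffel_sym (dM Uy) (uM Uy) gsymM).
have dDf x' : differentiable (fun z => 'D_x' f z) y.
  by case: fC => _ /(_ x')[+ _]; exact.
apply/rowP => j.
have entry x1 x2 : ('D_x1 ('D_x2 f) y) 0 j = 'D_x1 ('D_x2 (fun z => f z 0 j)) y.
  rewrite (derive_entry _ _ _ (dDf x2)).
  have E z : U z -> ('D_x2 f z) 0 j = 'D_x2 (fun z => f z 0 j) z.
    by move=> Uz; rewrite derive_entry//; exact: df.
  exact: near_eq_derive (open_near_eq oU Uy E).
apply: eq_trans (entry x v) _; apply: eq_trans _ (esym (entry v x)).
exact: derive_comm oU Uy (Ck_on_entry 0 j oU fC).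
Qed.

Lemma map_second_form_linearr x a v v' :
  S y x (a *: v + v') = a *: S y x v + S y x v'.
Proof.
rewrite !map_second_formE [(_ + v') *m J]mulmxDl -scalemxAl.
have lin (q1 q2 : 'rV[R]_n) (r1 r2 : 'rV[R]_m) q r :
    q = a *: q1 + q2 -> r = a *: r1 + r2 ->
    (a *: v + v') *m 'D_x (jacobian f) y + q - r *m J =
    a *: (v *m 'D_x (jacobian f) y + q1 - r1 *m J)
    + (v' *m 'D_x (jacobian f) y + q2 - r2 *m J).
  move: ('D_x (jacobian f) y) => K -> ->.
  rewrite !mulmxDl -!scalemxAl.
  by rewrite addrACA -scalerDr opprD addrACA -scalerBr.
apply: lin.
  exact: (christoffel_linearr (dB (fUV Uy)) (uB (fUV Uy))).
exact: (christoffel_linearr (dM Uy) (uM Uy)).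
Qed.

Lemma map_second_form_linearl a x x' v :
  S y (a *: x + x') v = a *: S y x v + S y x' v.
Proof.
by rewrite map_second_form_sym map_second_form_linearr !(map_second_form_sym v).
Qed.

(** The chain rule for covariant Hessians: the Christoffel term of the base
    that the second fundamental form of f adds is the one that the Hessian of w
    subtracts. *)
Lemma hess_form_comp (w : 'rV[R]_n -> R) x v : Ck_on 2 V w ->
  hess_form gM (w \o f) y x v =
  hess_form gB w (f y) (x *m J) (v *m J) + (S y x v *m grad w (f y)) 0 0.
Proof.
move=> wC; have [dw _] := wC.
have gradC : Ck_on 1 V (grad w).
  apply: Ck_on_mx => // i j; under eq_fun do rewrite mxE.
  by case: wC => _; exact.
have dgrad z : V z -> differentiable (grad w) z by case: gradC => + _; exact.
have gradE z : U z -> grad (w \o f) z = 'J f z *m grad w (f z).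
  by move=> Uz; apply: grad_comp; [exact: df|exact/dw/fUV].
have Dcomp v' z : U z -> 'D_v' (w \o f) z = (v' *m 'J f z *m grad w (f z)) 0 0.
  move=> Uz; rewrite derive_grad ?gradE ?mulmxA//.
  by apply: differentiable_comp; [exact: df|exact/dw/fUV].
have dgf : differentiable (fun z => grad w (f z)) y.
  exact: differentiable_comp (df Uy) (dgrad _ (fUV Uy)).
have dvJ : differentiable (fun z => v *m 'J f z) y.
  by apply: differentiable_mulmx => //; exact: dJ.
have DD : 'D_x ('D_v (w \o f)) y =
    (v *m 'D_x (jacobian f) y *m grad w (f y)) 0 0
    + 'D_(x *m J) ('D_(v *m J) w) (f y).
  rewrite (near_eq_derive _ (open_near_eq oU Uy (Dcomp v))).
  rewrite -derive_entry; last exact: differentiable_mulmx.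
  have -> : 'D_x (fun z => v *m 'J f z *m grad w (f z)) y =
      'D_x (fun z => v *m 'J f z) y *m grad w (f y)
      + v *m J *m 'D_x (fun z => grad w (f z)) y by exact: derive_mulmx.
  have -> : 'D_x (fun z => v *m 'J f z) y = v *m 'D_x (jacobian f) y.
    exact: derive_mulmxl (dJ Uy).
  have -> : 'D_x (fun z => grad w (f z)) y = 'D_(x *m J) (grad w) (f y).
    rewrite /J -deriveEjacobian; last exact: df.
    exact: derive_comp (df Uy) (dgrad _ (fUV Uy)).
  rewrite mxE; congr (_ + _).
  have E z : V z -> 'D_(v *m J) w z = (v *m J *m grad w z) 0 0.
    by move=> Vz; rewrite derive_grad//; exact: dw.
  rewrite (near_eq_derive _ (open_near_eq oV (fUV Uy) E)).
  rewrite -derive_entry; last first.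
    by apply: differentiable_mulmx => //; exact/dgrad/fUV.
  by rewrite (derive_mulmxl (v *m J) _ (dgrad _ (fUV Uy))).
have split3 (p q r : 'rV[R]_n) (k : 'cV[R]_n) (b : R) :
    (p *m k) 0 0 + b - (r *m k) 0 0 =
    b - (q *m k) 0 0 + ((p + q - r) *m k) 0 0.
  by rewrite mulmxBl mulmxDl !mxE; ring.
by rewrite /hess_form DD gradE// map_second_formE mulmxA; exact: split3.
Qed.

End AtPoint.
End LocalMap.

(** * Submersions with minimal fibers *)

(** The argument that makes the Levi-Civita connection unique: a trilinear
    quantity symmetric in its first two arguments and antisymmetric in its last
    two vanishes. *)
Lemma sym_antisym0 (R : realType) (T : Type) (s : T -> T -> T -> R) :
  (forall a b c, s a b c = s b a c) -> (forall a b c, s a b c = - s a c b) ->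
  forall a b c, s a b c = 0.
Proof.
move=> sy an a b c; have : s a b c = - s a b c.
  by rewrite {1}an (sy a c) an opprK (sy c b) an (sy b a).
by move=> h; lra.
Qed.

(** Bookkeeping for the derivative of an isometry condition.  DB and DM are the
    derivatives of the metrics, which metric compatibility expresses by the
    Christoffel terms cB and cM; when the derivatives of the pullback metric
    and of GM agree on v and w, the Christoffel terms combine into second
    fundamental forms. *)
Lemma second_form_algebra (R : realType) m n (GM : 'M[R]_m) (GB : 'M[R]_n)
    (J : 'M[R]_(m, n)) (vP wP cBv cBw vJ wJ : 'rV[R]_n) (cMv cMw v w : 'rV[R]_m)
    (DB DM : R) :
  form GB vP wJ + DB + form GB vJ wP = DM ->
  DB = form GB cBv wJ + form GB vJ cBw ->
  DM = form GM cMv w + form GM v cMw ->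
  form GB (cMv *m J) wJ = form GM cMv w ->
  form GB vJ (cMw *m J) = form GM v cMw ->
  form GB (vP + cBv - cMv *m J) wJ = - form GB vJ (wP + cBw - cMw *m J).
Proof.
move=> E EB EM Ev Ew.
rewrite !form_addl !form_addr form_oppl form_oppr Ev Ew.
by rewrite EB EM in E; lra.
Qed.

Section LocalSubmersion.
Variables (R : realType) (m n : nat).
Variables (gM : 'rV[R]_m -> 'M[R]_m) (gB : 'rV[R]_n -> 'M[R]_n).
Variables (f : 'rV[R]_m -> 'rV[R]_n).
Variables (U : set 'rV[R]_m) (V : set 'rV[R]_n).
Hypotheses (oU : open U) (oV : open V) (fUV : forall z, U z -> V (f z)).
Hypothesis fC : smooth_on U f.
Hypotheses (CM : Ck_on 1 U gM)
  (sM : forall z, U z -> (gM z)^T = gM z)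
  (uM : forall z, U z -> gM z \in unitmx).
Hypotheses (dB : forall z, V z -> differentiable gB z)
  (sB : forall z, V z -> (gB z)^T = gB z)
  (uB : forall z, V z -> gB z \in unitmx).
Hypothesis cometric : forall z, U z ->
  covector_lift (gM z) ('J f z) *m 'J f z = invmx (gB (f z)).

Variable y : 'rV[R]_m.
Hypothesis Uy : U y.
Let J := 'J f y.
Let L := covector_lift (gM y) J.
Local Notation S := (map_second_form gM gB f y).

Let dM z : U z -> differentiable gM z.
Proof. by case: CM => + _; exact. Qed.
Let df z : U z -> differentiable f z.
Proof. by case: (fC 1) => + _; exact. Qed.
Let dJ z : U z -> differentiable (jacobian f) z.
Proof. by have [+ _] := jacobian_Ck oU (fC 2); exact. Qed.
Let dgBf z : U z -> differentiable (fun z => gB (f z)) z.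
Proof. by move=> Uz; exact: differentiable_comp (df Uz) (dB (fUV Uz)). Qed.

(* The pullback of the metric of the base. *)
Let K z := 'J f z *m gB (f z) *m ('J f z)^T.

Let dK z : U z -> differentiable K z.
Proof.
move=> Uz; apply: differentiable_mulmx.
  by apply: differentiable_mulmx; [exact: dJ|exact: dgBf].
by have [] := derive_trmx 0 (dJ Uz).
Qed.

Let DK x v w : form ('D_x K y) v w =
  form (gB (f y)) (v *m 'D_x (jacobian f) y) (w *m J)
  + form ('D_(x *m J) gB (f y)) (v *m J) (w *m J)
  + form (gB (f y)) (v *m J) (w *m 'D_x (jacobian f) y).
Proof.
have [dJT DJT] := derive_trmx x (dJ Uy).
have dJB : differentiable (fun z => 'J f z *m gB (f z)) y.
  by apply: differentiable_mulmx; [exact: dJ|exact: dgBf].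
have -> : 'D_x K y = 'D_x (fun z => 'J f z *m gB (f z)) y *m J^T
   + J *m gB (f y) *m 'D_x (fun z => ('J f z)^T) y.
  exact: (derive_mulmx x dJB dJT).
have -> : 'D_x (fun z => 'J f z *m gB (f z)) y = 'D_x (jacobian f) y *m gB (f y)
   + J *m 'D_x (fun z => gB (f z)) y.
  exact: (derive_mulmx x (dJ Uy) (dgBf Uy)).
have -> : 'D_x (fun z => gB (f z)) y = 'D_(x *m J) gB (f y).
  rewrite /J -deriveEjacobian; last exact: df.
  exact: derive_comp (df Uy) (dB (fUV Uy)).
rewrite DJT; move: ('D_x _ y) ('D_(x *m J) gB (f y)) (gB (f y)) => P Q G.
by rewrite mulmxDl !form_addm !form_mulmx.
Qed.

Let horizontal_kernel z (a : 'rV[R]_n) : U z ->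
  a *m covector_lift (gM z) ('J f z) *m (gM z - K z) = 0.
Proof.
move=> Uz; rewrite -mulmxA mulmxBr /K !mulmxA cometric// mulVmx ?mul1mx.
  by rewrite /covector_lift mulmxKV ?uM// subrr mulmx0.
exact/uB/fUV.
Qed.

(* Horizontal vectors lie in the kernel of gM - K at every point, so the
   derivative of gM - K vanishes on pairs of them.  The horizontal field X that
   witnesses this uses the adjugate, which is differentiable. *)
Let horizontal_derive x (a b : 'rV[R]_n) :
  form ('D_x gM y) (a *m L) (b *m L) = form ('D_x K y) (a *m L) (b *m L).
Proof.
pose X z := a *m ('J f z)^T *m \adj (gM z).
pose N z := gM z - K z.
have XE z : U z -> X z = \det (gM z) *: (a *m covector_lift (gM z) ('J f z)).
  move=> Uz; have uz := uM Uz.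
  rewrite /X /covector_lift !mulmxA /invmx uz -!scalemxAr scalerA.
  rewrite mulfV ?scale1r//.
  by rewrite -unitfE -unitmxE.
have dX : differentiable X y.
  apply: differentiable_mulmx.
    apply: differentiable_mulmx => //.
    by have [] := derive_trmx 0 (dJ Uy).
  by have [+ _] := Ck_on_adj oU CM; exact.
have dN : differentiable N y by apply: differentiableB; [exact: dM|exact: dK].
have XN0 z : U z -> X z *m N z = 0.
  by move=> Uz; rewrite XE// -scalemxAl horizontal_kernel// scaler0.
have D0 : 'D_x X y *m N y + X y *m 'D_x N y = 0.
  transitivity ('D_x (fun z => X z *m N z) y).
    by apply/esym; exact: derive_mulmx.
  rewrite (near_eq_derive x (open_near_eq oU Uy XN0)); exact: derive_cst.
have Nw : N y *m (b *m L)^T = 0.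
  have sN : (N y)^T = N y.
    rewrite /N /K linearB/= sM// !trmx_mul trmxK (sB (fUV Uy)) mulmxA //.
  by rewrite -sN -trmx_mul horizontal_kernel// trmx0.
have XDN : X y *m 'D_x N y *m (b *m L)^T = 0.
  move: ('D_x X y) ('D_x N y) D0 => P Q D0.
  have := congr1 (mulmx^~ (b *m L)^T) D0.
  by rewrite mul0mx mulmxDl -(mulmxA P) Nw mulmx0 add0r.
have DN : 'D_x N y = 'D_x gM y - 'D_x K y.
  by apply: deriveB; apply: diff_derivable; [exact: dM|exact: dK].
move: XDN; rewrite DN; move: ('D_x gM y) ('D_x K y) => P Q.
rewrite XE// -/J -/L -!scalemxAl => /matrixP/(_ 0 0).
rewrite mxE [RHS]mxE => /eqP; rewrite mulf_eq0 => /orP[/eqP d0|].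
  by have := uM Uy; rewrite unitmxE d0 unitr0.
by rewrite mulmxBr mulmxBl mxE [X in _ + X]mxE subr_eq0 => /eqP.
Qed.

Let uBy : gB (f y) \in unitmx. Proof. exact/uB/fUV. Qed.
Let sBy : (gB (f y))^T = gB (f y). Proof. exact/sB/fUV. Qed.
Let LJ : L *m J = invmx (gB (f y)). Proof. exact: cometric. Qed.

Let pullback_horizontal v b :
  form (gB (f y)) (v *m J) (b *m L *m J) = form (gM y) v (b *m L).
Proof.
have := horizontal_kernel b Uy; rewrite -/J -/L mulmxBr => /eqP.
rewrite subr_eq0 => /eqP E.
rewrite (form_sym v _ (sM Uy)) (form_sym (v *m J) _ sBy) -form_mulmx.
by rewrite /Defs.form E.
Qed.

Let S_skew x a b :
  form (gB (f y)) (S x (a *m L)) (b *m L *m J) =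
  - form (gB (f y)) (a *m L *m J) (S x (b *m L)).
Proof.
have gsymM : \forall z \near y, (gM z)^T = gM z by exact: open_near_eq oU Uy sM.
have gsymB : \forall z \near f y, (gB z)^T = gB z.
  exact: open_near_eq oV (fUV Uy) sB.
rewrite !(map_second_formE gM gB oU (fC 2) Uy).
have E := horizontal_derive x a b; rewrite DK in E.
apply: second_form_algebra (esym E) _ _ _ _.
- exact: metric_compat (dB (fUV Uy)) uBy gsymB _ _ _.
- exact: metric_compat (dM Uy) (uM Uy) gsymM _ _ _.
- exact: pullback_horizontal.
- rewrite (form_sym (a *m L *m J) _ sBy) pullback_horizontal.
  by rewrite (form_sym _ _ (sM Uy)).
Qed.

(** Differentiating the isometry condition makes the second fundamental form,
    once lowered with gB, antisymmetric in its last two arguments, while it is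
    symmetric in the first two.  Geometrically, horizontal geodesics project to
    geodesics. *)
Lemma second_form_horizontal a b : S (a *m L) (b *m L) = 0.
Proof.
have S_sym x v : S x v = S v x.
  exact: (map_second_form_sym oU oV fUV (fC 2) dM sM uM dB sB uB Uy).
have s0 := @sym_antisym0 R 'rV[R]_n
  (fun a b c => form (gB (f y)) (S (a *m L) (b *m L)) (c *m L *m J)) _ _.
apply: (form_nondeg uBy) => w; rewrite /Defs.form !mul0mx [RHS]mxE.
have := s0 _ _ a b (w *m gB (f y)).
rewrite -(mulmxA _ L) LJ mulmxK//; apply.
- by move=> a' b' c'; rewrite S_sym.
- by move=> a' b' c'; rewrite S_skew (form_sym _ _ sBy).
Qed.

Section Fibers.
Let E := row_base (kermx J).
Hypothesis minimal : forall k (X : 'I_k -> 'rV[R]_m -> 'rV[R]_m),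
  (forall a, smooth_on U (X a)) ->
  (forall a z, U z -> vertical ('J f z) (X a z)) ->
  let E := \matrix_(a < k) X a y in
  row_free E -> (E == kermx ('J f y))%MS ->
  mean_curvature (gM y) E (fun a b => cov_deriv gM id (X b) (X a y) y) = 0.

Let EJ : E *m J = 0.
Proof. by apply/sub_kermxP; rewrite eq_row_base. Qed.

Let C := gB (f y) *m L.
(* A polynomial multiple of the projection onto the vertical space along the
   rows of C: its values are vertical everywhere, and it is the projection
   itself at y, where C J = 1.  It extends the basis E of the vertical space at
   y to smooth vertical fields. *)
Let Q z := (\det (C *m 'J f z))%:M - 'J f z *m \adj (C *m 'J f z) *m C.

Let CJ : C *m J = 1%:M.
Proof. by rewrite /C -mulmxA LJ mulmxV. Qed.

Let QJ z : Q z *m 'J f z = 0.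
Proof.
rewrite /Q mulmxBl -!mulmxA mul_adj_mx mul_scalar_mx mul_mx_scalar.
by rewrite subrr.
Qed.

Let Q_smooth : smooth_on U Q.
Proof.
move=> k; have CJf : Ck_on k U (fun z => C *m 'J f z).
  by apply: Ck_on_mulmx => //; [exact: Ck_on_cst|exact: jacobian_Ck (fC k.+1)].
have Jf := jacobian_Ck oU (fC k.+1).
apply: Ck_onD => //.
  apply: Ck_on_mx => // i j; under eq_fun do rewrite mxE.
  case: (i == j) => /=; last exact: Ck_on_cst.
  by under eq_fun do rewrite mulr1n; exact: Ck_on_det.
have -> : (fun z => - ('J f z *m \adj (C *m 'J f z) *m C)) =
    (fun z => 'J f z *m \adj (C *m 'J f z) *m (- C)).
  by apply/funext => z; rewrite mulmxN.
apply: Ck_on_mulmx => //; last exact: Ck_on_cst.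
by apply: Ck_on_mulmx => //; exact: Ck_on_adj.
Qed.

Let EQy : E *m Q y = E.
Proof.
by rewrite /Q mulmxBr CJ det1 mulmx1 !mulmxA -/J EJ !mul0mx subr0.
Qed.

Let X a z := row a E *m Q z.

Let Xy a : X a y = row a E.
Proof. by rewrite /X -row_mul EQy. Qed.

Let dX a : differentiable (X a) y.
Proof.
have dQ : differentiable Q y by exact: (Q_smooth 1).1.
exact: (differentiable_mulmx (differentiable_cst (row a E) y) dQ).
Qed.

Let DXJ a x : 'D_x (X a) y *m J = - (row a E *m 'D_x (jacobian f) y).
Proof.
have XJ0 z : U z -> X a z *m 'J f z = 0.
  by move=> _; rewrite /X -mulmxA QJ mulmx0.
have := near_eq_derive x (open_near_eq oU Uy XJ0).
have -> : 'D_x (fun z => X a z *m 'J f z) y =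
    'D_x (X a) y *m J + X a y *m 'D_x (jacobian f) y.
  exact: (derive_mulmx x (dX a) (dJ Uy)).
have -> : 'D_x (fun z : 'rV[R]_m => 0 : 'rV[R]_n) y = 0 by exact: derive_cst.
by rewrite Xy; move/eqP; rewrite addr_eq0 => /eqP.
Qed.

(** Minimality of the fibers, seen from the base.  Projecting the mean curvature
    of the fiber to the base forgets the normal projection and the vertical
    part; and differentiating X J = 0 for a vertical field X turns the
    projected covariant derivative of X into minus the second fundamental form
    of f. *)
Lemma second_form_vertical_trace :
  \sum_a \sum_b invmx (gram (gM y) E) a b *: S (row a E) (row b E) = 0.
Proof.
have EX : \matrix_a X a y = E by apply/row_matrixP => a; rewrite rowK Xy.
have mX := @minimal _ X.
have : mean_curvature (gM y) (\matrix_a X a y)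
         (fun a b => cov_deriv gM id (X b) (X a y) y) = 0.
  apply: mX.
  - move=> a k.
    exact: (Ck_on_mulmx oU (Ck_on_cst k U (row a E)) (Q_smooth k)).
  - by move=> a z _; rewrite /vertical /X -mulmxA QJ mulmx0.
  - by rewrite EX row_base_free.
  - by rewrite EX; apply/eqmxP; exact: eq_row_base.
rewrite EX => /(congr1 (mulmx^~ J)); rewrite mul0mx /mean_curvature.
rewrite mulmx_suml => mc0; apply: oppr_inj; rewrite oppr0 -[RHS]mc0 -sumrN.
apply: eq_bigr => a _; rewrite mulmx_suml -sumrN; apply: eq_bigr => b _.
rewrite -scalemxAl -scalerN; congr (_ *: _).
rewrite /normal_part mulmxBl -[_ *m E *m J]mulmxA EJ mulmx0 subr0.
rewrite /cov_deriv derive_id !Xy mulmxDl DXJ.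
rewrite (map_second_formE gM gB oU (fC 2) Uy) -!row_mul EJ !row0.
have c0 : christoffel gB (f y) 0 0 = 0.
  have := christoffel_linearr (dB (fUV Uy)) uBy (-1) 0 0 0.
  by rewrite scaler0 addr0 scaleN1r addNr.
by rewrite c0 addr0 opprB addrC.
Qed.

(** By the chain rule for Hessians, [graph_trace] applies with T the second
    fundamental form of f paired with dw; its hypotheses on T are the two
    vanishing properties proved above. *)
Lemma soliton_equation_submersion (w : 'rV[R]_n -> R) (eps : R) :
  Ck_on 2 V w ->
  (gM y + eps *: (grad (w \o f) y *m (grad (w \o f) y)^T) \in unitmx /\
   \tr (invmx (gM y + eps *: (grad (w \o f) y *m (grad (w \o f) y)^T))
        *m (hess gM (w \o f) y)^T) = 1) <->
  (gB (f y) + eps *: (grad w (f y) *m (grad w (f y))^T) \in unitmx /\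
   \tr (invmx (gB (f y) + eps *: (grad w (f y) *m (grad w (f y))^T))
        *m (hess gB w (f y))^T) = 1).
Proof.
move=> wC; have [dw _] := wC; set d := grad w (f y).
have gsymB : \forall z \near f y, (gB z)^T = gB z.
  exact: open_near_eq oV (fUV Uy) sB.
have -> : grad (w \o f) y = J *m d.
  exact: grad_comp (df Uy) (dw _ (fUV Uy)).
pose s x v := (S x v *m d) 0 0.
pose T : 'M[R]_m := \matrix_(a, b) s (delta_mx 0 a) (delta_mx 0 b).
have sT x v : s x v = form T x v.
  have lin (a : R) (p q r : 'rV[R]_n) : r = a *: p + q ->
      (r *m d) 0 0 = a * (p *m d) 0 0 + (q *m d) 0 0.
    by move=> ->; rewrite mulmxDl -scalemxAl !mxE.
  apply: bilinear_mx => *; apply: lin.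
    exact: (map_second_form_linearl oU oV fUV (fC 2) dM sM uM dB sB uB Uy).
  exact: (map_second_form_linearr oU fUV (fC 2) dM uM dB uB Uy).
have hessE : hess gM (w \o f) y = J *m hess gB w (f y) *m J^T + T.
  apply/matrixP => a b; rewrite mxE.
  rewrite (hess_form_comp gM gB oU oV fUV (fC 2) Uy _ _ wC).
  rewrite (hess_formE oV (fUV Uy) wC (dB (fUV Uy)) uBy gsymB).
  by rewrite -!rowE form_row [RHS]mxE [T a b]mxE.
have LTL : L *m T *m L^T = 0.
  apply/matrixP => i j; rewrite -form_row -sT !rowE /s second_form_horizontal.
  by rewrite mul0mx !mxE.
have trE : \tr (invmx (gram (gM y) E) *m (E *m T *m E^T)^T) = 0.
  have /(congr1 (fun v => (v *m d) 0 0)) := second_form_vertical_trace.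
  rewrite mul0mx [RHS]mxE => <-; rewrite mulmx_suml summxE.
  apply: eq_bigr => a _; rewrite mxE mulmx_suml summxE; apply: eq_bigr => b _.
  rewrite -scalemxAl [RHS]mxE; congr (_ * _).
  by rewrite mxE -form_row -sT.
have defL : L *m gM y = J^T by rewrite /L /covector_lift mulmxKV// uM.
have freeE : row_free E by exact: row_base_free.
have kerE : (E == kermx J)%MS by apply/eqmxP; exact: eq_row_base.
rewrite (graph_gram_unit (sM Uy) (uM Uy) sBy uBy defL LJ freeE kerE).
by split=> -[uh <-]; split=> //; rewrite hessE
  (graph_trace (sM Uy) (uM Uy) sBy uBy defL LJ freeE kerE).
Qed.

End Fibers.
End LocalSubmersion.

(** * Charts *)

Section Charts.
Variables (R : realType).

Lemma pointK (T : topologicalType) n (c : chart R T n) y :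
  cimg c y -> cdom c (point c y) /\ c (point c y) = y.
Proof. by case=> p cp <-; rewrite coordK. Qed.

Lemma local_domE (S T : topologicalType) m n (c : chart R S m) (d : chart R T n)
    (h : S -> T) :
  local_dom c d h = cimg c `&` [set y | cdom d (h (point c y))].
Proof.
apply/seteqP; split=> y /=.
  by case=> p [cp dp] <-; split; [exists p|rewrite coordK].
by case=> cy dy; have [cp pK] := pointK cy; exists (point c y).
Qed.

Lemma local_dom_open (S T : topologicalType) m n (c : chart R S m)
    (d : chart R T n) (h : S -> T) : continuous h -> open (local_dom c d h).
Proof.
move=> ch; rewrite local_domE openE => y [cy dy].
have hc : {for y, continuous (h \o point c)}.
  have [cp pK] := pointK cy.
  apply: continuous_comp; last exact: ch.
  by rewrite -[X in prop_for X]pK; exact: point_continuous.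
have ocy : nbhs y (cimg c).
  by apply: open_nbhs_nbhs; split=> //; exact: cimg_open.
have ody : nbhs (h (point c y)) (cdom d).
  by apply: open_nbhs_nbhs; split=> //; exact: cdom_open.
exact: filterI ocy (hc _ ody).
Qed.

End Charts.

Section HarmonicSubmersion.
Variables (R : realType) (m n : nat).
Variables (M : semiRiemannian R m) (B : semiRiemannian R n) (h : M -> B).
Hypothesis harm : harmonic_submersion h.

Section Pair.
Variables (i : chart_index M) (j : chart_index B).
Let U := local_dom (chart_at i) (chart_at j) h.
Let V := cimg (chart_at j).
Let f := local_rep (chart_at i) (chart_at j) h.

Let oU : open U.
Proof. by apply: local_dom_open; case: harm => -[[]]. Qed.
Let oV : open V. Proof. exact: cimg_open. Qed.
Let U_cimg z : U z -> cimg (chart_at i) z.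
Proof. by rewrite /U local_domE => -[]. Qed.
Let fUV z : U z -> V (f z).
Proof.
by rewrite /U local_domE => -[cz dz]; exists (h (point (chart_at i) z)).
Qed.
Let fC : smooth_on U f.
Proof. by case: harm => -[[_ +] _ _] _; exact. Qed.

Lemma pullback_Ck (u : B -> R) : Ck_function 2 u ->
  Ck_on 2 U (u \o h \o point (chart_at i)).
Proof.
move=> uC; have := Ck_on_comp oU fUV (fC 2) (uC j).
apply: Ck_on_ext => // z; rewrite /U local_domE => -[cz dz] /=.
by rewrite /f /local_rep /= coordK.
Qed.

Let cometric z : U z ->
  covector_lift (metric i z) ('J f z) *m 'J f z = invmx (metric j (f z)).
Proof.
move=> Uz; have [[_ _ /(_ i j z Uz)[fullJ nd iso _]] _] := harm.
apply: cometric_submersion => //.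
- exact/Defs.metric_sym/U_cimg.
- exact/metric_nondegenerate/U_cimg.
Qed.

(** In the two charts the graphs have heights w \o f and w, with w the
    coordinate expression of u. *)
Lemma soliton_at (eps : R) (u : B -> R) y :
  eps != 0 -> Ck_function 2 u -> U y ->
  (let F := prod_coord i \o (fun x => (x, u (h x))) \o point (chart_at i) in
   let G := prod_metric eps i in
   let E := 'J F y in
   gram (G (F y)) E \in unitmx /\
   mean_curvature (G (F y)) E
     (fun a b => cov_deriv G F (fun z => 'D_(basis_vec R b) F z)
                           (basis_vec R a) y)
   = normal_part (G (F y)) E (d_t R m)) <->
  (let F := prod_coord j \o (fun x => (x, u x)) \o point (chart_at j) in
   let G := prod_metric eps j in
   let E := 'J F (f y) in
   gram (G (F (f y))) E \in unitmx /\
   mean_curvature (G (F (f y))) E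
     (fun a b => cov_deriv G F (fun z => 'D_(basis_vec R b) F z)
                           (basis_vec R a) (f y))
   = normal_part (G (F (f y))) E (d_t R n)).
Proof.
move=> eps0 uC Uy.
pose w := u \o point (chart_at j).
have wC : Ck_on 2 V w by exact: uC.
have wfC : Ck_on 2 U (w \o f) by exact: Ck_on_comp oU fUV (fC 2) wC.
have dM z : U z -> differentiable (metric i) z.
  by move=> /U_cimg cz; exact: (metric_smooth i 1).1.
have dB z : V z -> differentiable (metric j) z by exact: (metric_smooth j 1).1.
have uM z : U z -> metric i z \in unitmx.
  by move=> /U_cimg; exact: metric_nondegenerate.
have uB z : V z -> metric j z \in unitmx by exact: metric_nondegenerate.
have FM z : U z ->
    (prod_coord i \o (fun x => (x, u (h x))) \o point (chart_at i)) z =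
    row_mx z ((w \o f) z)%:M.
  rewrite /U local_domE => -[cz dz]; have [_ pK] := pointK cz.
  by rewrite /prod_coord /= pK /w /f /local_rep /= coordK.
have FB z : V z -> (prod_coord j \o (fun x => (x, u x)) \o point (chart_at j)) z
    = row_mx z (w z)%:M.
  by move=> cz; have [_ pK] := pointK cz; rewrite /prod_coord /= pK.
have eqM := graph_soliton_eq oU Uy wfC FM (dM _ Uy) (uM _ Uy) eps0.
have eqB := graph_soliton_eq oV (fUV Uy) wC FB (dB _ (fUV Uy))
  (uB _ (fUV Uy)) eps0.
apply: iff_trans eqM _; apply: iff_trans _ (iff_sym eqB).
apply: (soliton_equation_submersion oU oV fUV fC _ _ _ _ _ _
  cometric Uy _ eps wC) => //.
- exact: Ck_on_sub U_cimg (metric_smooth i 1).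
- by move=> z /U_cimg; exact: Defs.metric_sym.
- by move=> z; exact: Defs.metric_sym.
move=> k X Xs Xv E freeE kerE; have [_ minh] := harm.
apply: (minh i j y Uy k U X oU Uy U_cimg Xs) => // a z Uz _.
exact: Xv.
Qed.

End Pair.
End HarmonicSubmersion.

Theorem corollary2 (R : realType) (m n : nat)
    (M : semiRiemannian R m) (B : semiRiemannian R n)
    (pi : M -> B) (hpi : harmonic_submersion pi)
    (eps : R) (heps : eps = 1 \/ eps = -1)
    (u : B -> R) (hu : Ck_function 2 u) :
  let F : B -> B * R := fun x => (x, u x) in
  let Ftilde : M -> M * R := fun x => (x, u (pi x)) in
  graphical_translating_soliton eps Ftilde <->
  graphical_translating_soliton eps F.
Proof.
move=> F Ftilde.
have eps0 : eps != 0 by case: heps => ->; rewrite ?oppr_eq0 oner_eq0.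
have [[[cpi _] surj _] _] := hpi.
split=> -[w [_ _ sol]].
- exists u; split=> // j q cq.
  have [p pq] := surj (point (chart_at j) q).
  have [i ip] := chart_cover p.
  have [dq qK] := pointK cq.
  have py : local_dom (chart_at i) (chart_at j) pi (chart_at i p).
    by exists p => //; split=> //=; rewrite pq.
  have fy : local_rep (chart_at i) (chart_at j) pi (chart_at i p) = q.
    by rewrite /local_rep /= coordK// pq.
  have := soliton_at hpi eps0 hu py; rewrite fy => -[+ _].
  by apply; apply: sol; exists p.
- exists (u \o pi); split=> //.
    move=> i; apply: Ck_on_glue => y cy.
    have [j jp] := chart_cover (pi (point (chart_at i) y)).
    exists (local_dom (chart_at i) (chart_at j) pi).
      by rewrite local_domE.
    exact: pullback_Ck.
  move=> i y cy; have [j jp] := chart_cover (pi (point (chart_at i) y)).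
  have Uy : local_dom (chart_at i) (chart_at j) pi y by rewrite local_domE.
  have [_] := soliton_at hpi eps0 hu Uy; apply; apply: sol.
  by exists (pi (point (chart_at i) y)).
Qed.
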